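(* Let $\lambda\in X$ be a dominant integral weight of $\mathfrak g$. Then $\mathbb B(\lambda)_{\rm cl}=\mathrm{QLS}(\lambda)$ as sets of piecewise-linear, continuous maps from $[0,1]$ to $\mathbb R\otimes_{\mathbb Z}X$; i.e. the projected level-zero Lakshmibai-Seshadri paths of shape $\lambda$ are exactly the quantum Lakshmibai-Seshadri paths of shape $\lambda$.
   Context: Root data. $\mathfrak g_{\rm af}$ is an untwisted affine Lie algebra with Dynkin index set $I_{\rm af}=I\sqcup\{0\}$, $\mathfrak g$ its finite-dimensional simple subalgebra with index set $I$, simple roots $\alpha_i$, coroots $\alpha_i^\vee$, roots $\Phi=\Phi^+\sqcup\Phi^-$, highest root $\theta$, Weyl group $W$ with reflections $r_\alpha$ and length $\ell$, weight lattice $X$, $\rho=\frac12\sum_{\alpha\in\Phi^+}\alpha$; $\langle\cdot,\cdot\rangle$ pairs coroots with weights. $J=\{i\in I:\langle\alpha_i^\vee,\lambda\rangle=0\}$, $W_J$ the parabolic subgroup (the stabilizer of $\lambda$), $W^J$ the minimal-length representatives of $W/W_J$, $\lfloor w\rfloor$ the minimal representative of $wW_J$, $\Phi_J^+$ the positive roots in the span of $\alpha_j$ ($j\in J$), $\rho_J=\frac12\sum_{\alpha\in\Phi_J^+}\alpha$. Level-zero lattice: $X_{\rm af}^0=X\oplus\mathbb Z\delta$ ($\delta$ the null root), $\mathrm{cl}:\mathbb R\otimes X_{\rm af}^0\to\mathbb R\otimes X$ the projection killing $\delta$; positive affine real roots $\Phi^{\rm af+}=\Phi^+\sqcup(\Phi+\mathbb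 Z_{>0}\delta)$; for $\beta=\alpha+n\delta$, $\langle\beta^\vee,\mu\rangle=\langle\alpha^\vee,\mathrm{cl}(\mu)\rangle$ and $r_\beta\mu=\mu-\langle\beta^\vee,\mu\rangle\beta$; the affine Weyl group $W_{\rm af}$ is generated by the $r_\beta$. LS paths. $X^0_{\rm af}(\lambda)=W_{\rm af}\lambda$ is partially ordered by the transitive closure of $\mu<r_\beta\mu$ for $\beta\in\Phi^{\rm af+}$, $\langle\beta^\vee,\mu\rangle>0$. For $b\in\mathbb Q$ and $\nu>\mu$ a $b$-chain for $(\nu,\mu)$ is a sequence of covers $\nu=\mu_0\gtrdot\mu_1\gtrdot\cdots\gtrdot\mu_m=\mu$ in this poset with $b\langle\beta_k^\vee,\mu_k\rangle\in\mathbb Z$ for all $k$, where $\beta_k\in\Phi^{\rm af+}$ is the root with $\mu_{k-1}=r_{\beta_k}\mu_k$. $\mathbb B(\lambda)$ is the set of LS paths of shape $\lambda$: pairs $(\nu_1>\cdots>\nu_s;\,0=b_0<b_1<\cdots<b_s=1)$, $\nu_k\in X^0_{\rm af}(\lambda)$, $b_k\in\mathbb Q$, such that there is a $b_k$-chain for $(\nu_k,\nu_{k+1})$ for each $1\le k\le s-1$; such a pair is identified with the map $\pi(t)=\sum_{k=1}^{l-1}(b_k-b_{k-1})\nu_k+(t-b_{l-1})\nu_l$ for $b_{l-1}\le t\le b_l$. $\mathbb B(\lambda)_{\rm cl}=\{\mathrm{cl}\circ\pi:\pi\in\mathbb B(\lambda)\}$. Parabolic quantum Bruhat graph $\mathrm{QB}(W^J)$: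 vertex set $W^J$; edges $w\xrightarrow{\alpha}\lfloor wr_\alpha\rfloor$ for $\alpha\in\Phi^+\setminus\Phi_J^+$ with either $\ell(wr_\alpha)=\ell(w)+1$ (Bruhat edge) or $\ell(\lfloor wr_\alpha\rfloor)=\ell(w)+1-\langle\alpha^\vee,2\rho-2\rho_J\rangle$ (quantum edge). For $b\in\mathbb Q$, $\mathrm{QB}_{b\lambda}(W^J)$ is the subgraph with the same vertices and only the edges with $b\langle\alpha^\vee,\lambda\rangle\in\mathbb Z$. QLS paths: $\mathrm{QLS}(\lambda)$ is the set of pairs $\eta=(x_1,\dots,x_s;b_0,\dots,b_s)$ with $x_k\in W^J$, $x_k\ne x_{k+1}$, rationals $0=b_0<\cdots<b_s=1$, such that there is a directed path from $x_{k+1}$ to $x_k$ in $\mathrm{QB}_{b_k\lambda}(W^J)$ for each $1\le k\le s-1$; $\eta$ is identified with the map $\eta(t)=\sum_{k=1}^{l-1}(b_k-b_{k-1})x_k\lambda+(t-b_{l-1})x_l\lambda$ for $b_{l-1}\le t\le b_l$. *)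

(* Defs.v *)
From HB Require Import structures.
From Stdlib Require Export Relation_Operators.
From mathcomp Require Export all_boot all_order all_algebra.
From mathcomp Require Export boolp classical_sets reals.
Set Implicit Arguments.
Unset Strict Implicit.
Unset Printing Implicit Defensive.
Import Order.TTheory GRing.Theory Num.Theory.
Local Open Scope classical_set_scope.
Local Open Scope ring_scope.

Section EuclideanSpace.
Context {R : realType} {n : nat}.
Implicit Types u v a : 'cV[R]_n.

Definition dot u v : R := \sum_i u i 0 * v i 0.

(* <a^vee, v>, where the coroot a^vee is identified with 2 a / (a, a). *)
Definition pair a v : R := 2 * dot a v / dot a a.

(* The matrix of v |-> v - <a^vee, v> a, acting on column vectors. *)
Definition refl a : 'M[R]_n := 1%:M - (2 / dot a a) *: (a *m a^T).

End EuclideanSpace.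

(* The root datum of a finite-dimensional simple Lie algebra of rank n: an
   irreducible reduced crystallographic root system in Euclidean n-space,
   together with a base.  The ambient space is the real span of the roots, and
   so is also R (x) X for the weight lattice X. *)
Record root_datum (R : realType) (n : nat) := RootDatum {
  roots : seq 'cV[R]_n;
  simple : 'I_n -> 'cV[R]_n;
  rank_gt0 : (0 < n)%N;
  roots_uniq : uniq roots;
  roots_neq0 : 0 \notin roots;
  roots_refl : forall a b, a \in roots -> b \in roots -> refl a *m b \in roots;
  roots_int : forall a b, a \in roots -> b \in roots ->
    pair a b \is a Num.int;
  roots_reduced : forall a (c : R), a \in roots -> c *: a \in roots ->
    c = 1 \/ c = -1;
  roots_irreducible : forall P : pred 'cV[R]_n,
    (forall a b, a \in roots -> b \in roots -> P a -> ~~ P b -> dot a b = 0) ->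
    all P roots \/ all (predC P) roots;
  simple_root : forall i, simple i \in roots;
  simple_free : forall c : 'I_n -> R,
    \sum_i c i *: simple i = 0 -> forall i, c i = 0;
  simple_base : forall a, a \in roots -> exists c : 'I_n -> nat,
    a = \sum_i (c i)%:R *: simple i \/ a = - \sum_i (c i)%:R *: simple i
}.

Section FiniteRootData.
Context {R : realType} {n : nat} (D : root_datum R n).
Local Notation V := 'cV[R]_n.
Implicit Types (a v lam : V) (w x y : 'M[R]_n) (J : pred 'I_n).

Definition positive_root a : Prop :=
  a \in roots D /\ exists c : 'I_n -> nat, a = \sum_i (c i)%:R *: simple D i.

(* Phi_J^+ *)
Definition positive_root_in J a : Prop :=
  positive_root a /\
  exists c : 'I_n -> R, a = \sum_(j | J j) c j *: simple D j.

Definition rho : V :=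
  2^-1 *: \sum_(a <- roots D | `[< positive_root a >]) a.

Definition rho_in J : V :=
  2^-1 *: \sum_(a <- roots D | `[< positive_root_in J a >]) a.

Definition weight v : Prop := forall i, pair (simple D i) v \is a Num.int.

Definition dominant v : Prop := forall i, 0 <= pair (simple D i) v.

Definition word (s : seq 'I_n) : 'M[R]_n :=
  \big[mulmx/1%:M]_(i <- s) refl (simple D i).

Definition weyl : set 'M[R]_n := [set w | exists s, w = word s].

Definition weyl_in J : set 'M[R]_n :=
  [set w | exists2 s, all J s & w = word s].

(* The length of w; the default value 0 only occurs outside the Weyl group. *)
Definition ell w : nat :=
  xget 0%N [set l | (exists2 s, w = word s & size s = l) /\
                    (forall s, w = word s -> (l <= size s)%N)].

(* W^J *)
Definition min_reps J : set 'M[R]_n :=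
  [set w | weyl w /\ forall u, weyl_in J u -> (ell w <= ell (w *m u))%N].

(* The minimal representative of w W_J; the default value w only occurs
   outside the Weyl group. *)
Definition floor_in J w : 'M[R]_n :=
  xget w [set x | min_reps J x /\ exists2 u, weyl_in J u & x = w *m u].

Definition stab_index lam : pred 'I_n :=
  fun i => pair (simple D i) lam == 0.

Definition bruhat_edge w a : Prop := ell (w *m refl a) = (ell w).+1.

Definition quantum_edge J w a : Prop :=
  (ell (floor_in J (w *m refl a)))%:R
  = (ell w)%:R + 1 - pair a (2 *: rho - 2 *: rho_in J).

(* The edges x --> y of QB_{b lam}(W^J). *)
Definition qb_edge lam (b : rat) x y : Prop :=
  let J := stab_index lam in
  min_reps J x /\
  exists a, [/\ positive_root a /\ ~ positive_root_in J a,
                y = floor_in J (x *m refl a),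
                bruhat_edge x a \/ quantum_edge J x a
              & ratr b * pair a lam \is a Num.int].

End FiniteRootData.

Section LevelZero.
Context {R : realType} {n : nat} (D : root_datum R n).

(* R (x) X_af^0; the second component is the coefficient of delta. *)
Definition af_space := ('cV[R]_n * R^o)%type.

Implicit Types (mu nu beta : af_space) (lam : 'cV[R]_n).

Definition cl mu : 'cV[R]_n := mu.1.

(* Phi^{af+}, with alpha + k delta encoded as (alpha, k). *)
Definition af_positive_root beta : Prop :=
  (positive_root D beta.1 /\ beta.2 = 0) \/
  (beta.1 \in roots D /\ exists k : nat, beta.2 = k.+1%:R).

Definition af_pair beta mu : R := pair beta.1 (cl mu).

Definition af_refl beta mu : af_space := mu - af_pair beta mu *: beta.

(* The generators r_beta are involutions, so that every element of the group
   W_af is a product of them. *)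
Definition af_weyl : set (af_space -> af_space) :=
  [set f | exists2 s : seq af_space,
     (forall beta, beta \in s -> af_positive_root beta)
     & forall mu, f mu = foldr af_refl mu s].

(* X_af^0(lam) *)
Definition af_orbit lam : set af_space := [set f (lam, 0) | f in af_weyl].

Definition af_lt_step lam mu nu : Prop :=
  af_orbit lam mu /\
  exists beta, [/\ af_positive_root beta, 0 < af_pair beta mu
                 & nu = af_refl beta mu].

Definition af_lt lam mu nu : Prop := clos_trans _ (af_lt_step lam) mu nu.

(* mu is covered by nu *)
Definition af_cover lam mu nu : Prop :=
  af_lt lam mu nu /\ ~ exists kap, af_lt lam mu kap /\ af_lt lam kap nu.

(* One step nu :> mu of a b-chain.  The positive affine root beta with
   nu = r_beta mu is unique, since nu <> mu. *)
Definition chain_step lam (b : rat) nu mu : Prop :=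
  af_cover lam mu nu /\
  exists beta, [/\ af_positive_root beta, nu = af_refl beta mu
                 & ratr b * af_pair beta mu \is a Num.int].

Definition b_chain lam (b : rat) nu mu : Prop :=
  clos_refl_trans _ (chain_step lam b) nu mu.

End LevelZero.

Section Paths.
Context {R : realType} {n : nat} (D : root_datum R n).

Definition unit_interval := {t : R | 0 <= t <= 1}.

(* 0 = b_0 < b_1 < ... < b_s = 1 *)
Definition breakpoints (s : nat) (b : seq rat) : Prop :=
  [/\ size b = s.+1, b`_0 = 0, b`_s = 1
    & forall k, (k < s)%N -> b`_k < b`_k.+1].

(* p is the piecewise-linear map given by the directions nu and breakpoints b;
   the k-th direction, counted from 1, is nu`_k.-1. *)
Definition pl_map (V : lmodType R) (nu : seq V) (b : seq rat)
    (p : unit_interval -> V) : Prop :=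
  forall (l : nat) (t : unit_interval), (1 <= l <= size nu)%N ->
    ratr b`_l.-1 <= val t <= ratr b`_l ->
    p t = \sum_(1 <= k < l) ratr (b`_k - b`_k.-1) *: nu`_k.-1
          + (val t - ratr b`_l.-1) *: nu`_l.-1.

Definition is_LS (lam : 'cV[R]_n) (nu : seq (@af_space R n)) (b : seq rat) :
    Prop :=
  [/\ breakpoints (size nu) b,
      (forall mu, mu \in nu -> af_orbit D lam mu)
    & forall k, (1 <= k < size nu)%N ->
        af_lt D lam nu`_k nu`_k.-1 /\ b_chain D lam b`_k nu`_k.-1 nu`_k].

Definition is_QLS (lam : 'cV[R]_n) (x : seq 'M[R]_n) (b : seq rat) : Prop :=
  [/\ breakpoints (size x) b,
      (forall w, w \in x -> min_reps D (stab_index D lam) w)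
    & forall k, (1 <= k < size x)%N ->
        x`_k.-1 <> x`_k /\
        clos_refl_trans _ (qb_edge D lam b`_k) x`_k x`_k.-1].

Definition LS (lam : 'cV[R]_n) : set (unit_interval -> @af_space R n) :=
  [set p | exists nu b, is_LS lam nu b /\ pl_map nu b p].

Definition LS_cl (lam : 'cV[R]_n) : set (unit_interval -> 'cV[R]_n) :=
  [set (fun t => cl (p t)) | p in LS lam].

Definition QLS (lam : 'cV[R]_n) : set (unit_interval -> 'cV[R]_n) :=
  [set p | exists x b,
     is_QLS lam x b /\ pl_map [seq w *m lam | w <- x] b p].

End Paths.

(* Main.v *)
(* The order on the orbit of lam is analysed without the semi-infinite Bruhat
   order.  For a vector v put
     N(v) = #{a > 0 : (a, v) < 0},   P(v) = sum of the roots a with (a, v) > 0,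
   so that N(x lam) = l(x) and P(x lam) = x (2 rho - 2 rho_J) for x in W^J, and
   for an affine root beta = g + k delta put
     E(v, beta) = N(r_g v) - N(v) + k <g^vee, P(v)>.
   The edges of QB(W^J) leaving x are given by E(x lam, beta) = 1, with k = 0
   for Bruhat and k = 1 for quantum edges.  If sigma = s + j delta is a simple
   affine root, then
     E(r_s v, r_sigma beta) = E(v, beta) + sgn (s, r_g v) - sgn (s, v).
   Choosing sigma with (s, g) > 0 makes r_sigma beta lower than beta, and an
   induction on beta shows that E >= 1 whenever (g, v) > 0, and that
   mu < r_beta mu is a cover iff E = 1.  Hence cl maps chains of covers to paths
   in QB(W^J), and these paths lift; LS paths and QLS paths correspond once
   consecutive directions with equal projections are merged. *)
Require Import Defs.
From mathcomp Require Import zify ring lra.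
Set Implicit Arguments.
Unset Strict Implicit.
Unset Printing Implicit Defensive.
Import Order.TTheory GRing.Theory Num.Theory.
Local Open Scope classical_set_scope.
Local Open Scope ring_scope.

(** * Reflections *)

(** The poset is not graded. In type A_2 with lambda = 2 omega_1 + omega_2, the points lambda and
    lambda - 2 delta are joined by a chain of two covers through r_1 lambda, and by a chain of four
    covers through r_2 lambda, lambda - delta and r_2 lambda - delta. A point of the orbit does not
    remember the translation that led to it, so E belongs to a point together with a reflection, not
    to a pair of endpoints: it is the difference of semi-infinite lengths that any choice of
    translation would give. Covers therefore cannot be recognized by adding lengths along chains.
    Instead r_sigma moves the whole interval between mu and nu = r_beta mu, and the signs of sigma
    at the two ends are compared. If the signs agree, E is unchanged and points strictly between mu
    and nu correspond, up to exceptions in which an end of one interval lies inside the other. If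
    the sign drops from mu to nu, then E is at least 2 and r_sigma mu or r_sigma nu lies strictly
    between. *)

Section Euclid.
Context {R : realType} {n : nat}.
Implicit Types (u v a b : 'cV[R]_n) (c : R).

Lemma dotC u v : dot u v = dot v u.
Proof. by apply: eq_bigr => i _; rewrite mulrC. Qed.

Lemma dotDl u v a : dot (u + v) a = dot u a + dot v a.
Proof. by rewrite /dot -big_split; apply: eq_bigr => i _; rewrite mxE mulrDl. Qed.

Lemma dotZl c u v : dot (c *: u) v = c * dot u v.
Proof. by rewrite /dot big_distrr; apply: eq_bigr => i _; rewrite mxE /= mulrA. Qed.

Lemma dotDr u v a : dot a (u + v) = dot a u + dot a v.
Proof. by rewrite dotC dotDl !(dotC a). Qed.

Lemma dotZr c u v : dot u (c *: v) = c * dot u v.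
Proof. by rewrite dotC dotZl dotC. Qed.

Lemma dotNl u v : dot (- u) v = - dot u v.
Proof. by rewrite -scaleN1r dotZl mulN1r. Qed.

Lemma dotNr u v : dot u (- v) = - dot u v.
Proof. by rewrite dotC dotNl dotC. Qed.

Lemma dotBl u v a : dot (u - v) a = dot u a - dot v a.
Proof. by rewrite dotDl dotNl. Qed.

Lemma dotBr u v a : dot a (u - v) = dot a u - dot a v.
Proof. by rewrite dotDr dotNr. Qed.

Lemma dot0l v : dot 0 v = 0.
Proof. by rewrite -(scale0r 0) dotZl mul0r. Qed.

Lemma dot_suml (I : Type) (r : seq I) (P : pred I) (F : I -> 'cV[R]_n) v :
  dot (\sum_(i <- r | P i) F i) v = \sum_(i <- r | P i) dot (F i) v.
Proof.
exact: (big_morph (fun u => dot u v) (fun x y => dotDl x y v) (dot0l v)).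
Qed.

Lemma dot_sumr (I : Type) (r : seq I) (P : pred I) (F : I -> 'cV[R]_n) v :
  dot v (\sum_(i <- r | P i) F i) = \sum_(i <- r | P i) dot v (F i).
Proof. by rewrite dotC dot_suml; apply: eq_bigr => i _; rewrite dotC. Qed.

Lemma dot_gt0 u : (0 < dot u u) = (u != 0).
Proof.
have Hge : 0 <= dot u u by apply: sumr_ge0 => i _; rewrite -expr2 sqr_ge0.
rewrite lt_def Hge andbT; congr (~~ _); apply/eqP/eqP => [/psumr_eq0P H|->].
  apply/matrixP => i j; rewrite ord1 mxE; apply/eqP.
  by rewrite -sqrf_eq0 expr2 H // => k _; rewrite -expr2 sqr_ge0.
exact: dot0l.
Qed.

Lemma dotE u v : u^T *m v = (dot u v)%:M.
Proof.
apply/matrixP => i j; rewrite !ord1 !mxE /= mulr1n.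
by apply: eq_bigr => k _; rewrite mxE.
Qed.

Lemma refl_mul a v : refl a *m v = v - pair a v *: a.
Proof.
rewrite /refl mulmxBl mul1mx -scalemxAl -mulmxA; congr (_ - _).
by rewrite dotE mul_mx_scalar scalerA /pair mulrAC.
Qed.

Lemma pairDr a u v : pair a (u + v) = pair a u + pair a v.
Proof. by rewrite /pair dotDr mulrDr mulrDl. Qed.

Lemma pairZr a c v : pair a (c *: v) = c * pair a v.
Proof. by rewrite /pair dotZr mulrCA !mulrA. Qed.

Lemma pairNr a v : pair a (- v) = - pair a v.
Proof. by rewrite -scaleN1r pairZr mulN1r. Qed.

Lemma pairBr a u v : pair a (u - v) = pair a u - pair a v.
Proof. by rewrite pairDr pairNr. Qed.

Lemma pairNl a v : pair (- a) v = - pair a v.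
Proof. by rewrite /pair !dotNl !dotNr opprK mulrN mulNr. Qed.

Lemma pair_sumr (I : Type) (r : seq I) (P : pred I) (F : I -> 'cV[R]_n) v :
  pair v (\sum_(i <- r | P i) F i) = \sum_(i <- r | P i) pair v (F i).
Proof. by rewrite /pair dot_sumr big_distrr big_distrl. Qed.

Lemma pair_id a : a != 0 -> pair a a = 2.
Proof. by rewrite -dot_gt0 => H; rewrite /pair mulfK // gt_eqF. Qed.

Lemma pair_gt0 a v : (0 < pair a v) = (0 < dot a v).
Proof.
have [->|a0] := eqVneq a 0; first by rewrite /pair !dot0l mulr0 mul0r.
by rewrite /pair pmulr_lgt0 ?invr_gt0 ?dot_gt0 // pmulr_rgt0 // ltr0n.
Qed.

Lemma pair_lt0 a v : (pair a v < 0) = (dot a v < 0).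
Proof. by rewrite -oppr_gt0 -pairNr pair_gt0 dotNr oppr_gt0. Qed.

Lemma pair_ge0 a v : (0 <= pair a v) = (0 <= dot a v).
Proof. by rewrite leNgt pair_lt0 -leNgt. Qed.

Lemma pair_eq0 a v : (pair a v == 0) = (dot a v == 0).
Proof. by rewrite !eq_le pair_ge0 -[_ <= 0]negbK -ltNge pair_gt0 -leNgt. Qed.

Lemma reflxx a : refl a *m a = - a.
Proof.
have [->|a0] := eqVneq a 0; first by rewrite mulmx0 oppr0.
by rewrite refl_mul pair_id // scaler_nat mulr2n opprD addrA subrr add0r.
Qed.

Lemma reflN a : refl (- a) = refl a.
Proof. by rewrite /refl !dotNl !dotNr opprK linearN /= mulNmx mulmxN opprK. Qed.

Lemma pair_dot a v : pair a v * dot a a = 2 * dot a v.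
Proof.
have [->|a0] := eqVneq a 0; first by rewrite !dot0l !mulr0.
by rewrite /pair divfK // gt_eqF // dot_gt0.
Qed.

Lemma dot_refl a u v : dot (refl a *m u) (refl a *m v) = dot u v.
Proof.
rewrite !refl_mul !dotBl !dotBr !dotZl !dotZr.
have -> : pair a v * dot u a = 2 * dot a v * dot a u / dot a a.
  by rewrite /pair (dotC u) mulrAC.
have -> : pair a u * (pair a v * dot a a) = pair a u * dot a v * 2.
  by rewrite pair_dot; ring.
have -> : 2 * dot a v * dot a u / dot a a = pair a u * dot a v.
  by rewrite /pair; ring.
ring.
Qed.

Lemma reflK a v : refl a *m (refl a *m v) = v.
Proof.
by rewrite (refl_mul a v) mulmxBr -scalemxAr reflxx scalerN opprK refl_mul subrK.
Qed.

Lemma refl_sqr a : refl a *m refl a = 1%:M.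
Proof.
apply/matrixP => i j.
have := reflK a (delta_mx j 0); rewrite mulmxA => /matrixP/(_ i 0).
by rewrite -!colE !mxE eqxx andbT => ->.
Qed.

Definition orthogonal (w : 'M[R]_n) : Prop := w^T *m w = 1%:M.

Lemma dot_orth w u v : orthogonal w -> dot (w *m u) (w *m v) = dot u v.
Proof.
move=> ow; have: (w *m u)^T *m (w *m v) = u^T *m v.
  by rewrite trmx_mul -mulmxA (mulmxA w^T) ow mul1mx.
by rewrite !dotE => /matrixP/(_ 0 0); rewrite !mxE /= !mulr1n.
Qed.

Lemma pair_orth w u v : orthogonal w -> pair (w *m u) (w *m v) = pair u v.
Proof. by move=> ow; rewrite /pair !dot_orth. Qed.

Lemma refl_tr a : (refl a)^T = refl a.
Proof. by rewrite /refl linearB /= linearZ /= trmx_mul trmxK trmx1. Qed.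

Lemma orth_refl a : orthogonal (refl a).
Proof. by rewrite /orthogonal refl_tr refl_sqr. Qed.

Lemma orthV w : orthogonal w -> w *m w^T = 1%:M.
Proof. exact: mulmx1C. Qed.

Lemma orth_mul w1 w2 : orthogonal w1 -> orthogonal w2 -> orthogonal (w1 *m w2).
Proof.
by move=> o1 o2; rewrite /orthogonal trmx_mul mulmxA -(mulmxA w2^T) o1 mulmx1.
Qed.

Lemma refl_orth w a : orthogonal w -> refl (w *m a) = w *m refl a *m w^T.
Proof.
move=> o; rewrite /refl dot_orth // trmx_mul mulmxBr mulmx1 mulmxBl orthV //.
by rewrite -scalemxAr -scalemxAl !mulmxA.
Qed.

Lemma refl_conj a b v :
  refl (refl a *m b) *m (refl a *m v) = refl a *m (refl b *m v).
Proof.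
by rewrite refl_orth ?refl_tr -?mulmxA ?reflK //; apply: orth_refl.
Qed.

Lemma pair_refl a u v : pair (refl a *m u) (refl a *m v) = pair u v.
Proof. by apply: pair_orth; apply: orth_refl. Qed.

Lemma dot_reflC a u v : dot (refl a *m u) v = dot u (refl a *m v).
Proof. by rewrite -(dot_refl a) reflK. Qed.

End Euclid.

(** * Roots *)

Lemma int_gt0_ge1 (R : realType) (x : R) : x \is a Num.int -> 0 < x -> 1 <= x.
Proof. by case/intrP=> m ->; rewrite ltr0z ler1z; lia. Qed.

Section Roots.
Context {R : realType} {n : nat} (D : root_datum R n).
Local Notation V := 'cV[R]_n.
Implicit Types (a b v u : V) (w : 'M[R]_n) (i j k : 'I_n).

Lemma root_neq0 a : a \in roots D -> a != 0.
Proof. by move=> aD; apply: contraNneq (roots_neq0 D) => <-. Qed.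

Lemma root_dot_gt0 a : a \in roots D -> 0 < dot a a.
Proof. by move/root_neq0; rewrite dot_gt0. Qed.

Lemma rootN a : (- a \in roots D) = (a \in roots D).
Proof.
suff H b : b \in roots D -> - b \in roots D.
  by apply/idP/idP => /H //; rewrite opprK.
by move=> bD; rewrite -reflxx roots_refl.
Qed.

Lemma roots_propto a b (c : R) : a \in roots D -> b \in roots D ->
  b = c *: a -> b = a \/ b = - a.
Proof.
move=> aD bD E; rewrite E in bD *.
by case: (roots_reduced aD bD) => ->; [left; rewrite scale1r|right; rewrite scaleN1r].
Qed.

Definition simple_mx : 'M[R]_n := \matrix_(i, j) simple D i j 0.

Lemma simple_mx_unit : simple_mx \in unitmx.
Proof.
rewrite -row_free_unit; apply: inj_row_free => v Hv.
apply/rowP => i; rewrite mxE.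
apply: (@simple_free _ _ D (fun i => v 0 i)).
apply/matrixP => j k; rewrite ord1 summxE mxE.
move/rowP: Hv => /(_ j); rewrite !mxE => E; rewrite -[RHS]E.
by apply: eq_bigr => l _; rewrite !mxE.
Qed.

Definition coweight k : V := col k (invmx simple_mx).

Lemma dot_simple_coweight i k : dot (simple D i) (coweight k) = (i == k)%:R.
Proof.
have /matrixP/(_ i k) := mulmxV simple_mx_unit; rewrite !mxE => <-.
by apply: eq_bigr => j _; rewrite !mxE.
Qed.

(** The vector rho^vee. It pairs to 1 with every simple root, so it is regular and dominant, and its
    Weyl orbit later computes [ell]. *)
Definition coheight : V := \sum_k coweight k.
Definition height a : R := dot a coheight.
Local Notation ht := height.

Lemma htE a : ht a = \sum_k dot a (coweight k).
Proof. exact: dot_sumr. Qed.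

Lemma ht_simple i : ht (simple D i) = 1.
Proof.
rewrite htE (bigD1 i) //= dot_simple_coweight eqxx big1 ?addr0 // => k ki.
by rewrite dot_simple_coweight eq_sym (negPf ki).
Qed.

Lemma htN a : ht (- a) = - ht a. Proof. exact: dotNl. Qed.
Lemma htB a b : ht (a - b) = ht a - ht b. Proof. exact: dotBl. Qed.
Lemma htZ c a : ht (c *: a) = c * ht a. Proof. exact: dotZl. Qed.

Lemma dot_comb_coweight (c : 'I_n -> R) k :
  dot (\sum_i c i *: simple D i) (coweight k) = c k.
Proof.
rewrite dot_suml (bigD1 k) //= dotZl dot_simple_coweight eqxx mulr1.
rewrite big1 ?addr0 // => i ik.
by rewrite dotZl dot_simple_coweight (negPf ik) mulr0.
Qed.

Lemma coweightP a b : (forall k, dot a (coweight k) = dot b (coweight k)) -> a = b.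
Proof.
move=> H; have Hm : a^T *m invmx simple_mx = b^T *m invmx simple_mx.
  apply/matrixP => i k; rewrite ord1.
  have := H k; rewrite /dot => E; rewrite !mxE.
  rewrite (eq_bigr (fun i => a i 0 * coweight k i 0)); last by move=> l _; rewrite !mxE.
  by rewrite E; apply: eq_bigr => l _; rewrite !mxE.
apply: trmx_inj; apply: (can_inj (mulmxK (_ : invmx simple_mx \in unitmx))) => //.
by rewrite unitmx_inv simple_mx_unit.
Qed.

Lemma comb_coweight a : a = \sum_i dot a (coweight i) *: simple D i.
Proof. by apply: coweightP => k; rewrite dot_comb_coweight. Qed.

Lemma root_sign a : a \in roots D ->
  (positive_root D a /\ forall k, 0 <= dot a (coweight k)) \/
  (positive_root D (- a) /\ forall k, dot a (coweight k) <= 0).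
Proof.
move=> aD; case: (simple_base aD) => c [E|E]; [left|right].
  split; first by split=> //; exists c.
  by move=> k; rewrite E dot_comb_coweight.
split; first by split; [rewrite rootN|exists c; rewrite E opprK].
by move=> k; rewrite E dotNl dot_comb_coweight oppr_le0.
Qed.

Lemma root_ht_neq0 a : a \in roots D -> ht a != 0.
Proof.
move=> aD; apply: contraTneq (root_neq0 aD) => h0; rewrite negbK; apply/eqP.
apply: coweightP => k; rewrite dot0l.
case: (root_sign aD) => -[_ H].
  by move: h0; rewrite htE => /psumr_eq0P; apply.
apply/eqP; rewrite -oppr_eq0 -dotNl; apply/eqP.
have: ht (- a) = 0 by rewrite htN h0 oppr0.
by rewrite htE => /psumr_eq0P; apply=> // l _; rewrite dotNl oppr_ge0.
Qed.

Lemma positive_ht_gt0 a : positive_root D a -> 0 < ht a.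
Proof.
move=> [aD [c E]]; rewrite lt_def root_ht_neq0 //= htE sumr_ge0 // => k _.
by rewrite E dot_comb_coweight.
Qed.

Lemma positive_rootE a : a \in roots D -> positive_root D a <-> 0 < ht a.
Proof.
move=> aD; split=> [|h]; first exact: positive_ht_gt0.
by case: (root_sign aD) => -[// /positive_ht_gt0]; rewrite htN; lra.
Qed.

Lemma positive_coweight_ge0 a k : a \in roots D -> 0 < ht a ->
  0 <= dot a (coweight k).
Proof.
move=> aD; case: (root_sign aD) => -[// /positive_ht_gt0]; rewrite htN; lra.
Qed.

Lemma positive_of_coweight a k : a \in roots D -> 0 < dot a (coweight k) -> 0 < ht a.
Proof.
move=> aD h; case: (root_sign aD) => -[/positive_ht_gt0 // _ /(_ k)].
lra.
Qed.

Lemma ht_int a : a \in roots D -> ht a \is a Num.int.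
Proof.
move=> aD; case: (simple_base aD) => c [E|E]; rewrite htE E.
  by apply: rpred_sum => k _; rewrite dot_comb_coweight intr_nat.
by apply: rpred_sum => k _; rewrite dotNl dot_comb_coweight rpredN intr_nat.
Qed.

Lemma ht_ge1 a : a \in roots D -> 0 < ht a -> 1 <= ht a.
Proof. by move=> aD; apply: int_gt0_ge1; apply: ht_int. Qed.

Lemma ht_lt0 a : a \in roots D -> (ht a < 0) = ~~ (0 < ht a).
Proof. by move=> aD; rewrite -leNgt le_eqVlt (negPf (root_ht_neq0 aD)). Qed.

(** The reflection changes only the coordinate at [simple D i]. By reducedness a positive root other
    than [simple D i] has another positive coordinate, and one positive coordinate decides the sign
    of a root. *)
Lemma refl_simple_pos i a : a \in roots D -> 0 < ht a -> a <> simple D i ->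
  0 < ht (refl (simple D i) *m a).
Proof.
move=> aD ha ai.
have [k ki kp] : exists2 k, k != i & 0 < dot a (coweight k).
  apply: contrapT => H.
  have E : a = dot a (coweight i) *: simple D i.
    rewrite {1}[a]comb_coweight (bigD1 i) //= big1 ?addr0 // => k ki.
    have := positive_coweight_ge0 k aD ha; rewrite le_eqVlt => /orP[/eqP <-|h].
      by rewrite scale0r.
    by case: H; exists k.
  case: (roots_propto (simple_root D i) aD E) => // E'.
  by move: ha; rewrite E' htN ht_simple; lra.
apply: (@positive_of_coweight _ k); first by rewrite roots_refl ?simple_root.
rewrite refl_mul dotBl dotZl dot_simple_coweight eq_sym (negPf ki) mulr0 subr0 //.
Qed.

Lemma positive_simple_pair a : a \in roots D -> 0 < ht a ->
  exists i, 0 < dot (simple D i) a.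
Proof.
move=> aD ha; apply: contrapT => H.
suff: dot a a <= 0 by have := root_dot_gt0 aD; lra.
rewrite {1}[a]comb_coweight dot_suml sumr_le0 // => i _.
rewrite dotZl mulr_ge0_le0 ?positive_coweight_ge0 // leNgt.
by apply/negP => h; apply: H; exists i.
Qed.

Lemma dominant_pos_dot v a : (forall i, 0 <= dot (simple D i) v) ->
  a \in roots D -> 0 < ht a -> 0 <= dot a v.
Proof.
move=> dv aD ha; rewrite [a]comb_coweight dot_suml sumr_ge0 // => i _.
by rewrite dotZl mulr_ge0 // positive_coweight_ge0.
Qed.

(** What is needed to reindex sums over the roots; besides the Weyl group it admits -1. *)
Definition permutes w := orthogonal w /\ (forall a, a \in roots D -> w *m a \in roots D).

Lemma perm_roots w : permutes w -> perm_eq (roots D) [seq w *m a | a <- roots D].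
Proof.
move=> [ow pw].
have winj : injective (mulmx w : V -> V).
  by move=> a b /(congr1 (mulmx w^T)); rewrite !mulmxA ow !mul1mx.
rewrite perm_sym; apply: uniq_perm.
- by rewrite map_inj_uniq // roots_uniq.
- exact: roots_uniq.
have := @uniq_min_size _ [seq w *m a | a <- roots D] (roots D).
case=> [|||_ H a].
- by rewrite map_inj_uniq // roots_uniq.
- by move=> _ /mapP[a aD ->]; apply: pw.
- by rewrite size_map leqnn.
by rewrite H.
Qed.

Lemma reindex_roots (T : nmodType) w (P : pred V) (F : V -> T) : permutes w ->
  \sum_(a <- roots D | P a) F a = \sum_(a <- roots D | P (w *m a)) F (w *m a).
Proof. by move=> pw; rewrite (perm_big _ (perm_roots pw)) big_map. Qed.

Lemma permutes_refl a : a \in roots D -> permutes (refl a).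
Proof.
by move=> aD; split=> [|b bD]; [apply: orth_refl|apply: roots_refl].
Qed.

Lemma permutes1 : permutes 1%:M.
Proof. by split=> [|a]; rewrite /orthogonal ?trmx1 mul1mx. Qed.

Lemma permutes_mul w1 w2 : permutes w1 -> permutes w2 -> permutes (w1 *m w2).
Proof.
move=> [o1 p1] [o2 p2]; split=> [|a aD]; first exact: orth_mul.
by rewrite -mulmxA p1 ?p2.
Qed.

End Roots.

(** * Simple affine roots *)

Lemma seq_argmax (R : realDomainType) (T : eqType) (f : T -> R) (s : seq T) x0 :
  x0 \in s -> exists2 x, x \in s & forall y, y \in s -> f y <= f x.
Proof.
elim: s x0 => // a s IH x0 _.
case: s IH => [|b s] IH; first by exists a; rewrite ?mem_head // => y /[1!inE] /eqP ->.
have [x xs Hx] := IH b (mem_head _ _).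
have [le|/ltW le] := leP (f a) (f x).
  exists x; first by rewrite inE xs orbT.
  by move=> y; rewrite inE => /orP[/eqP -> //|/Hx].
exists a; first exact: mem_head.
by move=> y; rewrite inE => /orP[/eqP -> //|/Hx H]; apply: le_trans le.
Qed.

Lemma sum_indicator_seq (R : pzRingType) (T : eqType) (r : seq T) (P : pred T) x :
  uniq r -> x \in r -> \sum_(y <- r | P y) (y == x)%:R = (P x)%:R :> R.
Proof.
move=> ur xr; rewrite big_mkcond (bigD1_seq x) //= eqxx big1_seq ?addr0.
  by case: (P x).
by move=> y /andP[/negPf -> _]; case: ifP.
Qed.

Lemma sub_indicator_sg (R : realDomainType) (x : R) :
  (0 < x)%R%:R - (x < 0)%R%:R = Num.sg x.
Proof.
have [h|h|->] := ltgtP x 0.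
- by rewrite (ltr0_sg h) sub0r.
- by rewrite (gtr0_sg h) subr0.
- by rewrite sgr0 subrr.
Qed.

Section AffineSimple.
Context {R : realType} {n : nat} (D : root_datum R n).
Local Notation V := 'cV[R]_n.
Local Notation ht := (height D).
Implicit Types (a b v u s : V) (w : 'M[R]_n) (i : 'I_n).

(* The affine root a + k delta is positive iff k is an integer >= e a. *)
Definition min_level a : R := (ht a < 0)%R%:R.
Local Notation e := min_level.

Lemma e_pos a : 0 < ht a -> e a = 0.
Proof. by move=> h; rewrite /min_level lt_gtF. Qed.

Lemma e_neg a : ht a < 0 -> e a = 1.
Proof. by rewrite /min_level => ->. Qed.

Lemma eN a : a \in roots D -> e (- a) = 1 - e a.
Proof.
move=> aD; rewrite /min_level htN oppr_lt0 (ht_lt0 aD).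
by case: (0 < ht a); rewrite ?subr0 ?subrr.
Qed.

(* For s with this property the affine root s + (e s) delta is simple:
   its reflection permutes the other positive affine roots. *)
Definition asimple s : Prop :=
  s \in roots D /\ forall a, a \in roots D -> a <> s -> a <> - s ->
    e (refl s *m a) = e a - e s * pair s a.

Lemma asimple_simple i : asimple (simple D i).
Proof.
split=> [|a aD ai aNi]; first exact: simple_root.
rewrite (e_pos (a := simple D i)) ?ht_simple // mul0r subr0.
have rD : refl (simple D i) *m a \in roots D by rewrite roots_refl ?simple_root.
have [h|h] := boolP (0 < ht a).
  by rewrite !e_pos //; apply: refl_simple_pos.
rewrite -ht_lt0 // in h; rewrite !e_neg //.
rewrite -oppr_gt0 -htN -mulmxN; apply: refl_simple_pos.
- by rewrite rootN.
- by rewrite htN oppr_gt0.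
- by move=> E; apply: aNi; rewrite -E opprK.
Qed.

(** Strict Cauchy-Schwarz: the component of [b] orthogonal to [a] is nonzero, since the only roots
    proportional to [a] are [a] and [- a]. *)
Lemma pair_lt4 a b : a \in roots D -> b \in roots D -> b <> a -> b <> - a ->
  pair a b * pair b a < 4.
Proof.
move=> aD bD ba bNa.
have a0 := root_dot_gt0 aD; have b0 := root_dot_gt0 bD.
have: b - (dot a b / dot a a) *: a != 0.
  apply/eqP => /subr0_eq E.
  by case: (roots_propto aD bD E).
rewrite -dot_gt0 dotBl !dotBr !dotZl !dotZr (dotC b a) divfK ?gt_eqF // => H.
have: 0 < dot b b - dot a b * dot a b / dot a a by move: H; lra.
rewrite subr_gt0 ltr_pdivrMr // => {}H.
rewrite /pair (dotC b a) mulf_div ltr_pdivrMr ?mulr_gt0 //.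
by move: H; lra.
Qed.

(** The two Cartan integers are positive with product below 4, so one of them is 1, and the
    corresponding reflection produces the difference up to sign. *)
Lemma root_sub a b : a \in roots D -> b \in roots D -> b <> a -> b <> - a ->
  0 < dot a b -> a - b \in roots D.
Proof.
move=> aD bD ba bNa ab.
have pa : 1 <= pair a b by apply: int_gt0_ge1; rewrite ?pair_gt0 ?(roots_int aD bD).
have pb : 1 <= pair b a.
  by apply: int_gt0_ge1; rewrite ?(roots_int bD aD) ?pair_gt0 1?dotC.
have lt4 := pair_lt4 aD bD ba bNa.
have [H|H] : pair a b = 1 \/ pair b a = 1.
- move: lt4 pa pb; have /intrP[x ->] := roots_int aD bD.
  have /intrP[y ->] := roots_int bD aD.
  rewrite -intrM !ler1z -[4]/(4%:~R) ltr_int => xy x1 y1.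
  have [->|->] : x = 1 \/ y = 1 by nia.
    by left.
  by right.
- by rewrite -opprB rootN; have := roots_refl aD bD; rewrite refl_mul H scale1r.
- by have := roots_refl bD aD; rewrite refl_mul H scale1r.
Qed.

(** This yields the affine node alpha_0 = - theta + delta. The root [t] is taken of greatest height
    among the roots pairing positively with [g]; maximality forces [pair t a] to be 0 or 1 for every
    positive [a] other than [t], and this number is the level needed after the reflection. *)
Lemma asimple_of_dominant g : g \in roots D -> 0 < ht g ->
  (forall i, 0 <= dot (simple D i) g) ->
  exists2 t, asimple (- t) & 0 < dot t g.
Proof.
move=> gD hg dg.
have g0 : g \in [seq b <- roots D | 0 < dot b g].
  by rewrite mem_filter gD andbT (root_dot_gt0 gD).
have [t + tmax] := seq_argmax ht g0.
rewrite mem_filter => /andP[tg tD].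
have {}tmax b : b \in roots D -> 0 < dot b g -> ht b <= ht t.
  by move=> bD bg; apply: tmax; rewrite mem_filter bg.
have ht0 : 0 < ht t by apply: lt_le_trans hg _; apply: tmax => //; apply: root_dot_gt0 gD.
have gpos a : a \in roots D -> 0 < ht a -> 0 <= dot a g by apply: dominant_pos_dot.
exists t => //; split; first by rewrite rootN.
rewrite e_neg ?htN ?oppr_lt0 //.
suff key a : a \in roots D -> 0 < ht a -> a <> t -> a <> - t ->
    e (refl t *m a) = pair t a.
  move=> a aD aNt at'; rewrite opprK in at'.
  rewrite reflN pairNl mul1r opprK.
  have [h|h] := boolP (0 < ht a); first by rewrite key // e_pos // add0r.
  rewrite -ht_lt0 // in h.
  have := key (- a); rewrite rootN htN oppr_gt0 => /(_ aD h).
  rewrite mulmxN eN ?roots_refl // (e_neg h) pairNr => H.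
  suff: 1 - e (refl t *m a) = - pair t a by lra.
  by apply: H => E; [apply: aNt|apply: at']; rewrite -[a]opprK E ?opprK.
move=> aD ha at' aNt.
(* Otherwise [refl a *m t] is [t] plus a positive multiple of the positive root [a]: it is higher
   than [t] and still pairs positively with [g]. *)
have p0 : 0 <= pair t a.
  rewrite pair_ge0 leNgt; apply/negP => H.
  have := tmax (refl a *m t); rewrite roots_refl // => /(_ isT).
  have pa : pair a t < 0 by rewrite pair_lt0 dotC.
  rewrite refl_mul htB htZ dotBl dotZl.
  have := gpos a aD ha; nra.
have /intrP[m Em] := roots_int tD aD.
have rD := roots_refl tD aD.
have [m1|[m1|]] : m = 0 \/ m = 1 \/ 2 <= m.
  by move: p0; rewrite Em ler0z; clear; lia.
- by rewrite Em m1 refl_mul Em m1 scale0r subr0 e_pos.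
- rewrite Em m1; apply: e_neg; rewrite ht_lt0 //; apply/negP => h.
  have := tmax a aD; have := gpos _ rD h.
  by move: h; rewrite refl_mul Em m1 scale1r htB dotBl; lra.
(* The root [- (refl t *m a)] is (m - 1) t + (t - a). If t - a is positive, this root is higher than
   [t] and pairs positively with [g]; if t - a is negative, [a] itself is such a root. *)
move=> m2; exfalso.
have ta : 0 < dot t a by rewrite -pair_gt0 Em ltr0z; move: m2; clear; lia.
have sD := root_sub tD aD at' aNt ta.
have [h|h] := boolP (0 < ht (t - a)); last first.
  rewrite -ht_lt0 // in h.
  have : 0 < ht (a - t) by rewrite -opprB htN oppr_gt0.
  move=> /gpos; rewrite -opprB rootN => /(_ sD).
  by have := tmax a aD; move: h; rewrite htB dotNl dotBl; lra.
have := tmax (- (refl t *m a)); rewrite rootN rD => /(_ isT).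
have m2' : 2 <= m%:~R :> R by rewrite -[2]/(2%:~R) ler_int.
rewrite refl_mul Em opprB htB htZ dotBl dotZl.
have := gpos _ sD h; move: h; rewrite htB dotBl; nra.
Qed.

(** When no simple root pairs positively with a negative [g], the root [- g] is dominant and the
    affine node takes over. *)
Lemma exists_asimple g : g \in roots D -> exists2 s, asimple s & 0 < dot s g.
Proof.
move=> gD; have [h|h] := boolP (0 < ht g).
  have [i Hi] := positive_simple_pair gD h; exists (simple D i) => //.
  exact: asimple_simple.
rewrite -ht_lt0 // in h.
have [[i Hi]|H] := pselect (exists i, 0 < dot (simple D i) g).
  by exists (simple D i) => //; apply: asimple_simple.
have [||i|t st tg] := @asimple_of_dominant (- g).
- by rewrite rootN.
- by rewrite htN oppr_gt0.
- by rewrite dotNr oppr_ge0 leNgt; apply/negP => Hi; apply: H; exists i.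
by exists (- t) => //; rewrite dotNl -dotNr.
Qed.

(* For x in W^J, [Nv (x lam)] is the length of x and [Pv (x lam)] is
   x (2 rho - 2 rho_J). *)
Definition Nv v : R := \sum_(a <- roots D | 0 < dot a v) e a.
Definition Pv v : V := \sum_(a <- roots D | 0 < dot a v) a.

Lemma Pv_perm w v : permutes D w -> Pv (w *m v) = w *m Pv v.
Proof.
move=> pw; rewrite /Pv (reindex_roots _ _ pw) mulmx_sumr.
by apply: eq_bigl => a; rewrite dot_orth //; case: pw.
Qed.

(** Away from [s] and [- s] the reflection changes [e] by a linear function of the root, which sums
    to the [Pv] term; the two exceptional roots are off by 1 and -1 and give the sign. *)
Lemma Nv_asimple s v : asimple s ->
  Nv (refl s *m v) = Nv v - e s * pair s (Pv v) + Num.sg (dot s v).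
Proof.
move=> [sD Hs]; rewrite {1}/Nv (reindex_roots _ _ (permutes_refl sD)).
have E a : a \in roots D -> e (refl s *m a) =
    e a - e s * pair s a + ((a == s)%:R - (a == - s)%:R).
  move=> aD; have sNs : (s == - s) = false.
    apply/eqP => /(congr1 ht); rewrite htN.
    by have := root_ht_neq0 sD => /eqP; lra.
  have [->|/eqP H1] := eqVneq a s.
    by rewrite sNs reflxx eN // pair_id ?(root_neq0 sD) //=; lra.
  have [->|/eqP H2] := eqVneq a (- s).
    by rewrite mulmxN reflxx opprK eN // pairNr pair_id ?(root_neq0 sD) //=; lra.
  by rewrite Hs // subrr addr0.
under eq_bigl => a do rewrite dot_refl.
rewrite big_seq_cond (eq_bigr _ (fun a aH => E a (andP aH).1)) -big_seq_cond.
rewrite !big_split /= -/(Nv v) sumrN sumrN -big_distrr /= /Pv pair_sumr.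
rewrite !sum_indicator_seq ?roots_uniq ?rootN //; congr (_ + _).
rewrite dotNl oppr_gt0.
exact: sub_indicator_sg.
Qed.

(** Antisymmetrizing the sum under [refl g] makes every term nonnegative, and the root [g] itself
    contributes [dot g g]. *)
Lemma Pv_pos g v : g \in roots D -> 0 < dot g v -> 0 < dot g (Pv v).
Proof.
move=> gD gv.
suff: 0 < dot g (Pv v) + dot g (Pv v) by lra.
have -> : dot g (Pv v) + dot g (Pv v) =
   \sum_(a <- roots D) dot g a * ((0 < dot a v)%R%:R - (0 < dot (refl g *m a) v)%R%:R).
  have E : dot g (Pv v) = \sum_(a <- roots D) dot g a * (0 < dot a v)%R%:R.
    rewrite dot_sumr big_mkcond; apply: eq_bigr => a _.
    by case: ifP; rewrite ?mulr1 ?mulr0.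
  under eq_bigr => a _ do rewrite mulrBr.
  rewrite sumrB -E; congr (_ + _).
  rewrite E (reindex_roots _ _ (permutes_refl gD)) -sumrN.
  apply: eq_bigr => a _; rewrite -mulNr; congr (_ * _).
  by rewrite -dot_reflC reflxx dotNl.
rewrite (bigD1_seq g) ?roots_uniq //= reflxx dotNl oppr_gt0 gv (lt_gtF gv) //= subr0 mulr1.
rewrite ltr_wpDr ?(root_dot_gt0 gD) //; apply: sumr_ge0 => a _.
rewrite refl_mul dotBl dotZl.
have [h|h|->] := ltgtP (dot g a) 0; last by rewrite mul0r.
  have pg : pair g a < 0 by rewrite pair_lt0.
  case: (ltP 0 (dot a v)) => H1; case: (ltP 0 (dot a v - _)) => H2 /=;
    rewrite ?subrr ?mulr0 //; nra.
have pg : 0 < pair g a by rewrite pair_gt0.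
case: (ltP 0 (dot a v)) => H1; case: (ltP 0 (dot a v - _)) => H2 /=;
  rewrite ?subrr ?mulr0 //; nra.
Qed.

Definition Ev v g k : R := Nv (refl g *m v) - Nv v + k * pair g (Pv v).

Lemma Ev_asimple v s : asimple s -> Ev v s (e s) = Num.sg (dot s v).
Proof. by move=> Hs; rewrite /Ev Nv_asimple //; ring. Qed.

(** The [Pv] terms that [Nv_asimple] yields at the two ends cancel against the shift of the level,
    because [Pv] is equivariant; only the signs survive. *)
Lemma Ev_refl v s g k : asimple s -> g \in roots D ->
  Ev (refl s *m v) (refl s *m g) (k - e s * pair s g) =
  Ev v g k + Num.sg (dot s (refl g *m v)) - Num.sg (dot s v).
Proof.
move=> Hs gD; have [sD _] := Hs.
have pP a u : a \in roots D -> Pv (refl a *m u) = refl a *m Pv u.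
  by move=> aD; apply: Pv_perm; apply: permutes_refl.
rewrite /Ev refl_conj !(Nv_asimple _ Hs) !pP // pair_refl.
rewrite [X in pair s X]refl_mul pairBr pairZr; ring.
Qed.

End AffineSimple.

(** * Positive affine roots and induction on them *)

Section AffineOrder.
Context {R : realType} {n : nat} (D : root_datum R n).
Local Notation V := 'cV[R]_n.
Local Notation Vaf := (@af_space R n).
Local Notation ht := (height D).
Local Notation e := (min_level D).
Implicit Types (a b v u s : V) (mu nu kap beta : Vaf).

Definition aroot beta : Prop :=
  beta.1 \in roots D /\ exists k : nat, beta.2 = e beta.1 + k%:R.

Lemma af_positive_rootE beta : af_positive_root D beta <-> aroot beta.
Proof.
case: beta => a r; rewrite /af_positive_root /aroot /=; split.
  case=> [[pa ->]|[aD [k ->]]].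
    have [aD _] := pa; split=> //; exists 0%N.
    by rewrite e_pos ?addr0 //; apply: positive_ht_gt0.
  split=> //; have [h|h] := boolP (0 < ht a).
    by exists k.+1; rewrite e_pos ?add0r.
  by exists k; rewrite e_neg ?ht_lt0 // -natr1 addrC.
case=> aD [k ->]; have [h|h] := boolP (0 < ht a).
  rewrite e_pos // add0r; case: k => [|k].
    by left; split=> //; apply/positive_rootE.
  by right; split=> //; exists k.
right; split=> //; exists k.
by rewrite e_neg ?ht_lt0 // -natr1 addrC.
Qed.

Lemma aroot_neq0 beta : aroot beta -> beta.1 != 0.
Proof. by case=> /root_neq0. Qed.

(** A height in which delta outweighs every [|ht a|], so that positive affine roots have height at
    least 1. It decreases strictly as one goes up in the orbit, and it bounds the induction on
    affine roots. *)
Definition aht mu : R := ht mu.1 + (1 + \sum_(a <- roots D) `|ht a|) * mu.2.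

Lemma aht_ge1 beta : aroot beta -> 1 <= aht beta.
Proof.
case: beta => a r [/= aD [k ->]]; rewrite /aht /=.
have S0 : `|ht a| <= \sum_(b <- roots D) `|ht b|.
  by rewrite (bigD1_seq a) ?roots_uniq //= lerDl sumr_ge0.
have k0 : 0 <= k%:R :> R by [].
have n0 := normr_ge0 (ht a).
have [h|h] := boolP (0 < ht a).
  by rewrite e_pos //; have := ht_ge1 aD h; nra.
have {}h : ht a < 0 by rewrite ht_lt0.
rewrite e_neg //; move: S0 n0; rewrite ltr0_norm //; nra.
Qed.

Lemma af_reflE beta mu :
  af_refl beta mu = (refl beta.1 *m mu.1, mu.2 - pair beta.1 mu.1 * beta.2).
Proof. by case: beta mu => [a r] [v t]; rewrite refl_mul. Qed.

Lemma aht_refl beta mu :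
  aht (af_refl beta mu) = aht mu - af_pair beta mu * aht beta.
Proof. by rewrite af_reflE /aht /= refl_mul htB htZ /af_pair /cl; ring. Qed.

Lemma pair_reflr a b v : pair a (refl b *m v) = pair a v - pair b v * pair a b.
Proof. by rewrite refl_mul pairBr pairZr. Qed.

Lemma af_reflK beta mu : beta.1 != 0 -> af_refl beta (af_refl beta mu) = mu.
Proof.
move=> b0; rewrite !af_reflE /= reflK; case: mu => v t /=; congr (_, _).
by rewrite pair_reflr pair_id //; ring.
Qed.

Lemma af_pair_refl beta mu nu :
  af_pair (af_refl beta mu) (af_refl beta nu) = af_pair mu nu.
Proof. by rewrite /af_pair !af_reflE /= pair_refl. Qed.

Lemma af_pair_reflE beta mu : beta.1 != 0 ->
  af_pair beta (af_refl beta mu) = - af_pair beta mu.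
Proof.
by move=> b0; rewrite /af_pair /cl af_reflE /= pair_reflr pair_id //; ring.
Qed.

Lemma af_refl_conj sig beta mu :
  af_refl sig (af_refl beta mu) = af_refl (af_refl sig beta) (af_refl sig mu).
Proof.
rewrite !af_reflE /= refl_conj pair_refl; congr (_, _).
by rewrite pair_reflr; ring.
Qed.

Definition asig s : Vaf := (s, e s).

Lemma aroot_asig s : asimple D s -> aroot (asig s).
Proof. by case=> sD _; split=> //; exists 0%N; rewrite addr0. Qed.

Lemma aroot_refl s beta : asimple D s -> aroot beta -> beta <> asig s ->
  aroot (af_refl (asig s) beta).
Proof.
move=> [sD Hs] [bD [k Ek]] bs; rewrite af_reflE /aroot /=.
split; first by rewrite roots_refl.
have s2 : pair s s = 2 by rewrite pair_id ?(root_neq0 sD).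
(* On the line of [s] the reflection moves the excess [k] over the minimal level by one, down from
   [s] and up from [- s]; excess 0 at [s] is [asig s] itself, which is excluded. *)
have [E|E1] := pselect (beta.1 = s).
  case: k Ek => [|k] Ek.
    by case: bs; rewrite /asig -E -[e beta.1]addr0 -Ek; case: (beta).
  exists k; rewrite Ek E reflxx s2 eN // -natr1; ring.
have [E|E2] := pselect (beta.1 = - s).
  exists k.+1; rewrite Ek E mulmxN reflxx opprK pairNr s2 eN // -natr1; ring.
by exists k; rewrite Hs // Ek; ring.
Qed.

(** The reflection lowers [aht] by the pairing times [aht (asig s)], and both factors are at least
    1. The sign of [dot s beta.1] is kept for use in the induction steps. *)
Lemma aroot_ind (P : Vaf -> Prop) :
  (forall beta s, aroot beta -> asimple D s -> 0 < dot s beta.1 ->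
     beta = asig s \/
     [/\ beta <> asig s, aroot (af_refl (asig s) beta) & P (af_refl (asig s) beta)] ->
     P beta) ->
  forall beta, aroot beta -> P beta.
Proof.
move=> IH beta rb.
have [N] : exists N : nat, aht beta <= N%:R.
  by exists (Num.truncn (aht beta)).+1; rewrite ltW // truncnS_gt.
elim: N beta rb => [|N IHN] beta rb leN; first by have := aht_ge1 rb; lra.
have [s ss sb] := exists_asimple rb.1.
apply: (IH _ s) => //; have [E|E] := pselect (beta = asig s); [by left|right].
have rb' := aroot_refl ss rb E; split=> //; apply: IHN => //.
rewrite aht_refl; have := aht_ge1 (aroot_asig ss).
have : 1 <= af_pair (asig s) beta.
  apply: int_gt0_ge1; rewrite ?pair_gt0 //.
  by apply: (roots_int (r := D)); [case: ss|case: rb].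
by move: leN; rewrite -natr1; nra.
Qed.

Definition Eaf beta mu : R := Ev D mu.1 beta.1 beta.2.

Lemma Eaf_refl s beta mu : asimple D s -> aroot beta ->
  Eaf (af_refl (asig s) beta) (af_refl (asig s) mu) =
  Eaf beta mu + Num.sg (af_pair (asig s) (af_refl beta mu))
  - Num.sg (af_pair (asig s) mu).
Proof.
move=> ss [bD _]; rewrite /Eaf !af_reflE /= mulrC Ev_refl //.
have sgE v : Num.sg (dot s v) = Num.sg (pair s v).
  have [h|h|h] := ltgtP (dot s v) 0.
  - by rewrite !ltr0_sg ?pair_lt0.
  - by rewrite !gtr0_sg ?pair_gt0.
  - by rewrite h /pair h mulr0 mul0r.
by rewrite !sgE.
Qed.

End AffineOrder.

(** * Covers in the affine orbit *)

Section AffineCovers.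
Context {R : realType} {n : nat} (D : root_datum R n) (lam : 'cV[R]_n).
Local Notation V := 'cV[R]_n.
Local Notation Vaf := (@af_space R n).
Local Notation lt := (af_lt D lam).
Local Notation orbit := (af_orbit D lam).
Implicit Types (s : V) (mu nu kap beta : Vaf).

Lemma orbit_refl beta mu : aroot D beta -> orbit mu -> orbit (af_refl beta mu).
Proof.
move=> rb [f [s Hs Hf] <-]; exists (fun mu => foldr (@af_refl R n) mu (beta :: s)).
  exists (beta :: s) => // g; rewrite inE => /orP[/eqP ->|/Hs //].
  exact/af_positive_rootE.
by rewrite /= Hf.
Qed.

Lemma af_lt_orbit mu nu : lt mu nu -> orbit mu /\ orbit nu.
Proof.
elim=> [a b [oa [beta [rb _ ->]]]|a b c _ [oa _] _ [_ oc] //].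
by split=> //; apply: orbit_refl => //; apply/af_positive_rootE.
Qed.

Lemma af_lt_trans mu nu kap : lt mu nu -> lt nu kap -> lt mu kap.
Proof. exact: t_trans. Qed.

Lemma af_lt_aht mu nu : lt mu nu -> aht D nu < aht D mu.
Proof.
elim=> [a b [_ [beta [/af_positive_rootE rb p ->]]]|a b c _ h1 _ h2]; last first.
  exact: lt_trans h1.
by rewrite aht_refl; have := aht_ge1 rb; nra.
Qed.

Lemma af_lt_irr mu : ~ lt mu mu.
Proof. by move/af_lt_aht; rewrite ltxx. Qed.

Lemma af_lt_refl beta mu : aroot D beta -> orbit mu -> 0 < af_pair beta mu ->
  lt mu (af_refl beta mu).
Proof.
move=> rb om p; apply: t_step; split=> //; exists beta; split=> //.
exact/af_positive_rootE.
Qed.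

Lemma af_refl_lt beta mu : aroot D beta -> orbit mu -> af_pair beta mu < 0 ->
  lt (af_refl beta mu) mu.
Proof.
move=> rb om p; have b0 := aroot_neq0 rb.
rewrite -[X in lt _ X](af_reflK mu b0); apply: af_lt_refl => //.
  exact: orbit_refl.
by rewrite af_pair_reflE // oppr_gt0.
Qed.

Definition af_le mu nu := mu = nu \/ lt mu nu.

Lemma af_le_lt_trans mu nu kap : af_le mu nu -> lt nu kap -> lt mu kap.
Proof. by move=> [->//|]; apply: af_lt_trans. Qed.

Lemma af_lt_le_trans mu nu kap : lt mu nu -> af_le nu kap -> lt mu kap.
Proof. by move=> h [<-//|]; apply: af_lt_trans. Qed.

(* The lifting property: the second alternative occurs when a step of the chain
   is the reflection in the simple root itself. *)
Lemma af_lt_asimple s mu nu : asimple D s -> lt mu nu ->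
  lt (af_refl (asig D s) mu) (af_refl (asig D s) nu) \/
  (af_le (af_refl (asig D s) mu) nu /\ af_le mu (af_refl (asig D s) nu)).
Proof.
move=> ss; have rs := aroot_asig ss; have s0 := aroot_neq0 rs.
elim=> {mu nu} [a b [oa [beta [/af_positive_rootE rb p ->]]]|a b c ab Hab bc Hbc].
  have [->|E] := pselect (beta = asig D s).
    by right; split; left; rewrite ?af_reflK.
  left; rewrite af_refl_conj; apply: af_lt_refl; first exact: aroot_refl.
    exact: orbit_refl.
  by rewrite af_pair_refl.
case: Hab => [h1|[h1 h1']]; case: Hbc => [h2|[h2 h2']].
- by left; apply: af_lt_trans h2.
- by right; split; right; [apply: af_lt_le_trans h2|apply: af_lt_le_trans h2'].
- by right; split; right; [apply: af_le_lt_trans bc|apply: af_le_lt_trans h2].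
- by right; split; right; [apply: af_le_lt_trans bc|apply: af_lt_le_trans h2'].
Qed.

(** Equal images make [beta] proportional to [asig s]. By reducedness [beta] is then [asig s] or its
    negative, and the negative is not a positive affine root. *)
Lemma af_refl_inj s beta mu : asimple D s -> aroot D beta -> beta <> asig D s ->
  af_pair beta mu != 0 -> af_refl (asig D s) mu <> af_refl beta mu.
Proof.
move=> ss rb bs p0 E.
have rs := aroot_asig ss; have rb' := aroot_refl ss rb bs.
have nE : af_pair (asig D s) mu *: asig D s = af_pair beta mu *: beta.
  by move: E => /(congr1 (fun x => mu - x)); rewrite /af_refl !subKr.
have bD := rb.1; have sD := rs.1.
have E1 : beta.1 = (af_pair beta mu)^-1 * af_pair (asig D s) mu *: s.
  move/(congr1 (fun x => x.1)): nE => /= nE.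
  by rewrite -scalerA nE scalerA mulVf // scale1r.
have [k Ek] := rb.2.
have E2 : af_pair (asig D s) mu * min_level D s = af_pair beta mu * beta.2.
  by move/(congr1 (fun x => x.2)): nE.
case: (roots_propto sD bD E1) => E3.
  apply: bs; case: beta E3 E2 p0 {rb nE bD E1 E Ek rb'} => a r /= -> E2 p0.
  by congr (_, _); apply/esym/(mulfI p0).
have pN : af_pair beta mu = - af_pair (asig D s) mu by rewrite /af_pair E3 pairNl.
move: E2; rewrite pN mulNr -mulrN => /mulfI E2.
have {}E2 : min_level D s = - beta.2 by apply: E2; rewrite -oppr_eq0 -pN.
move: E2; rewrite Ek E3 eN // => E2.
by have : 0 <= k%:R :> R by []; lra.
Qed.

Lemma le_sg (x y : R) : x <= y -> Num.sg x <= Num.sg y.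
Proof.
move=> xy; have [h|h|h] := ltgtP x 0.
- rewrite (ltr0_sg h); have [h'|h'|->] := ltgtP y 0.
  + by rewrite ltr0_sg.
  + by rewrite gtr0_sg //; lra.
  + by rewrite sgr0; lra.
- by rewrite !gtr0_sg //; apply: lt_le_trans xy.
- rewrite h sgr0; move: xy; rewrite h le_eqVlt => /orP[/eqP <-|h'].
    by rewrite sgr0.
  by rewrite gtr0_sg.
Qed.

Lemma lt_sg_cases (x y : R) : x < y -> Num.sg x < Num.sg y \/
  (Num.sg x = Num.sg y /\ ((0 < x /\ 0 < y) \/ (x < 0 /\ y < 0))).
Proof.
move=> xy; have [h|h|h] := ltgtP x 0; have [h'|h'|h'] := ltgtP y 0.
- by right; rewrite !ltr0_sg //; split=> //; right.
- by left; rewrite (ltr0_sg h) (gtr0_sg h'); lra.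
- by left; rewrite (ltr0_sg h) h' sgr0; lra.
- by lra.
- by right; rewrite !gtr0_sg //; split=> //; left.
- by lra.
- by lra.
- by left; rewrite h sgr0 (gtr0_sg h').
- by lra.
Qed.

Lemma pair_refl_asimple_lt s beta mu : aroot D beta ->
  0 < dot s beta.1 -> 0 < af_pair beta mu ->
  af_pair (asig D s) (af_refl beta mu) < af_pair (asig D s) mu.
Proof.
move=> rb sb p; rewrite /af_pair /cl af_reflE /= pair_reflr.
by rewrite gtrBl mulr_gt0 // pair_gt0.
Qed.

Lemma Eaf_asig s mu : asimple D s -> 0 < af_pair (asig D s) mu ->
  Eaf D (asig D s) mu = 1.
Proof.
move=> ss p; rewrite /Eaf /= Ev_asimple // gtr0_sg //.
by rewrite -pair_gt0.
Qed.

(** The pairing with sigma drops from mu to r_beta mu, so by [Eaf_refl] passing to the reflected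
    pair never increases E, and the bound comes back from there. *)
Lemma Eaf_ge1 beta mu : aroot D beta -> 0 < af_pair beta mu -> 1 <= Eaf D beta mu.
Proof.
move=> rb; elim/(@aroot_ind R n D): beta / rb mu => beta s rb ss sb IH mu p.
case: IH => [E|[bs rb' IH]]; first by rewrite E Eaf_asig -?E.
have := IH (af_refl (asig D s) mu); rewrite af_pair_refl => /(_ p).
rewrite Eaf_refl //.
have := le_sg (ltW (pair_refl_asimple_lt rb sb p)); lra.
Qed.

Lemma not_cover_of_Eaf beta mu : aroot D beta -> orbit mu -> 0 < af_pair beta mu ->
  Eaf D beta mu <> 1 -> exists kap, lt mu kap /\ lt kap (af_refl beta mu).
Proof.
move=> rb; elim/(@aroot_ind R n D): beta / rb mu => beta s rb ss sb IH mu om p E1.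
case: IH => [E|[bs rb' IH]]; first by case: E1; rewrite E Eaf_asig -?E.
have rs := aroot_asig ss; have s0 := aroot_neq0 rs.
have on := orbit_refl rb om.
have psm := pair_refl_asimple_lt rb sb p.
have ineq : af_refl (asig D s) mu <> af_refl beta mu.
  by apply: af_refl_inj => //; rewrite gt_eqF.
have ineq' : mu <> af_refl (asig D s) (af_refl beta mu).
  by move=> E; apply: ineq; rewrite E af_reflK // -E.
have lt' : lt (af_refl (asig D s) mu) (af_refl (asig D s) (af_refl beta mu)).
  rewrite af_refl_conj; apply: af_lt_refl => //; first exact: orbit_refl.
  by rewrite af_pair_refl.
set nu := af_refl beta mu in lt' ineq ineq' on psm *.
(* If the sign drops, the point between is r_sigma nu when sigma is negative at nu; otherwise sigma
   vanishes at nu, is positive at mu, and the point is r_sigma mu. *)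
case: (lt_sg_cases psm) => [sgl|[sge sgs]].
  have [h|h] := ltP (af_pair (asig D s) nu) 0.
    have [h'|h'] := leP (af_pair (asig D s) mu) 0.
      exists (af_refl (asig D s) nu); split; last exact: af_refl_lt.
      have E : af_pair (asig D s) mu = 0.
        apply/eqP; rewrite eq_le h' leNgt; apply/negP => h2.
        by move: sgl; rewrite !ltr0_sg // ltxx.
      by move: lt'; rewrite {1}/af_refl E scale0r subr0.
    exists (af_refl (asig D s) nu); split; last exact: af_refl_lt.
    by apply: af_lt_trans lt'; apply: af_lt_refl.
  have h' : 0 < af_pair (asig D s) mu by apply: le_lt_trans psm.
  exists (af_refl (asig D s) mu); split; first exact: af_lt_refl.
  have E : af_pair (asig D s) nu = 0.
    apply/eqP; rewrite eq_le h andbT leNgt; apply/negP => h2.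
    by move: sgl; rewrite !gtr0_sg // ltxx.
  by move: lt'; rewrite [X in lt _ X]/af_refl E scale0r subr0.
have [||| kap [k1 k2]] := IH (af_refl (asig D s) mu).
- exact: orbit_refl.
- by rewrite af_pair_refl.
- by rewrite Eaf_refl // -/nu sge addrK.
rewrite -af_refl_conj -/nu in k2.
(* With equal signs E is the same for the reflected pair, so induction gives [kap] in the reflected
   interval. Either [kap] reflects back, or the exceptions of [af_lt_asimple] give the second
   alternative; there the common nonzero sign of sigma puts r_sigma mu or r_sigma nu in between. *)
have key : (lt mu (af_refl (asig D s) kap) /\ lt (af_refl (asig D s) kap) nu) \/
           (lt mu (af_refl (asig D s) nu) /\ lt (af_refl (asig D s) mu) nu).
  have leN mu' nu' : af_le mu' nu' -> mu' <> nu' -> lt mu' nu' by case.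
  move: (af_lt_asimple ss k1) (af_lt_asimple ss k2); rewrite !af_reflK //.
  case=> [h1|[h1 h1']] [h2|[h2 h2']].
  - by left.
  - right; split; apply: leN => //; right.
      exact: af_lt_le_trans h2.
    exact: af_lt_le_trans h2'.
  - right; split; apply: leN => //; right.
      exact: af_le_lt_trans k2.
    exact: af_le_lt_trans h2.
  - right; split; apply: leN => //; right.
      exact: af_le_lt_trans k2.
    exact: af_lt_le_trans h2'.
case: key => [[h1 h2]|[h1 h2]]; first by exists (af_refl (asig D s) kap).
case: sgs => -[h h'].
  by exists (af_refl (asig D s) mu); split=> //; apply: af_lt_refl.
by exists (af_refl (asig D s) nu); split=> //; apply: af_refl_lt.
Qed.

(** E is at least 1 for the reflected pair and cannot be larger than for the given one. So E = 1 is
    inherited and the signs at both ends agree; the reflected pair is a cover by induction, and a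
    point between mu and nu would put a point between its ends. *)
Lemma cover_of_Eaf beta mu : aroot D beta -> orbit mu -> 0 < af_pair beta mu ->
  Eaf D beta mu = 1 -> af_cover D lam mu (af_refl beta mu).
Proof.
move=> rb; elim/(@aroot_ind R n D): beta / rb mu => beta s rb ss sb IH mu om p E1.
split; first exact: af_lt_refl.
move=> [kap [k1 k2]].
have rs := aroot_asig ss; have s0 := aroot_neq0 rs.
have on := orbit_refl rb om.
move: (af_lt_asimple ss k1) (af_lt_asimple ss k2).
case: IH => [E|[bs rb' IH]].
  (* For beta = sigma the reflection exchanges the two ends, and every outcome of [af_lt_asimple]
     closes a cycle. *)
  move: k2; rewrite E af_reflK // => k2.
  case=> [h1|[h1 _]]; last by move: (af_le_lt_trans h1 k2) => /af_lt_irr.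
  case=> [h2|[h2 _]].
    by apply: (@af_lt_irr mu); apply: af_lt_trans k1 (af_lt_trans k2 (af_lt_trans h1 h2)).
  by move: (af_lt_le_trans h1 h2) => /af_lt_irr.
set nu := af_refl beta mu in k2 on *.
have psm := pair_refl_asimple_lt rb sb p.
have E2 := Eaf_refl mu ss rb.
have [||| _ NC] := IH (af_refl (asig D s) mu).
- exact: orbit_refl.
- by rewrite af_pair_refl.
- have := Eaf_ge1 rb' (mu := af_refl (asig D s) mu).
  rewrite af_pair_refl E2 => /(_ p); have := le_sg (ltW psm); lra.
rewrite -af_refl_conj -/nu in NC.
have sge : Num.sg (af_pair (asig D s) nu) = Num.sg (af_pair (asig D s) mu).
  have := Eaf_ge1 rb' (mu := af_refl (asig D s) mu).
  rewrite af_pair_refl E2 -/nu => /(_ p); have := le_sg (ltW psm); rewrite -/nu; lra.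
have ineq : af_refl (asig D s) mu <> nu.
  by apply: af_refl_inj => //; rewrite gt_eqF.
have ineq' : mu <> af_refl (asig D s) nu.
  by move=> E; apply: ineq; rewrite E af_reflK // -E.
have [|[_ sgs]] := lt_sg_cases psm; first by rewrite -/nu sge ltxx.
move=> H1 H2.
(* These relations hold when [kap] fails to reflect properly; then nu, if sigma is positive at both
   ends, or else mu, lies inside the reflected interval. *)
suff [h1 h2] : lt (af_refl (asig D s) mu) nu /\ lt mu (af_refl (asig D s) nu).
  apply: NC; case: sgs => -[h h'].
    by exists nu; split=> //; apply: af_lt_refl.
  by exists mu; split=> //; apply: af_refl_lt.
have leN mu' nu' : af_le mu' nu' -> mu' <> nu' -> lt mu' nu' by case.
case: H1 H2 => [h1|[h1 h1']] [h2|[h2 h2']].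
- by case: NC; exists (af_refl (asig D s) kap).
- by split; apply: leN => //; right; [apply: af_lt_le_trans h2|apply: af_lt_le_trans h2'].
- by split; apply: leN => //; right; [apply: af_le_lt_trans k2|apply: af_le_lt_trans h2].
- by split; apply: leN => //; right; [apply: af_le_lt_trans k2|apply: af_lt_le_trans h2'].
Qed.

(** Lowering the level by one lowers E by [pair beta.1 (Pv D mu.1)], which is positive, so E = 1 at
    a higher level would contradict [Eaf_ge1] one level below. *)
Lemma Eaf_min beta mu : aroot D beta -> 0 < af_pair beta mu -> Eaf D beta mu = 1 ->
  beta.2 = min_level D beta.1.
Proof.
move=> [bD [[|k] Ek]] p E1; first by rewrite Ek addr0.
exfalso; have : 1 <= Eaf D (beta.1, min_level D beta.1 + k%:R) mu.
  by apply: Eaf_ge1 => //; split=> //; exists k.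
rewrite leNgt => /negP; apply.
move: E1; rewrite /Eaf /Ev /= Ek -natr1.
have : 0 < pair beta.1 (Pv D mu.1).
  by rewrite pair_gt0 Pv_pos //; move: p; rewrite /af_pair pair_gt0.
lra.
Qed.

Lemma lt_pair_gt0 beta mu : aroot D beta -> lt mu (af_refl beta mu) ->
  0 < af_pair beta mu.
Proof.
move=> rb h; have := af_lt_aht h; rewrite aht_refl; have := aht_ge1 rb; nra.
Qed.

(** The finite part of [beta] thus determines the cover: its level is 0 for a positive root and 1
    for a negative one, which is the origin of Bruhat and quantum edges. *)
Lemma coverP beta mu : aroot D beta -> orbit mu ->
  af_cover D lam mu (af_refl beta mu) <->
  [/\ 0 < af_pair beta mu, beta.2 = min_level D beta.1
    & Ev D mu.1 beta.1 (min_level D beta.1) = 1].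
Proof.
move=> rb om; split=> [C|[p Eb E1]].
  have p := lt_pair_gt0 rb C.1.
  have E1 : Eaf D beta mu = 1.
    by apply: contrapT => /(not_cover_of_Eaf rb om p); case: C.
  have Eb := Eaf_min rb p E1; split=> //.
  by move: E1; rewrite /Eaf Eb.
by apply: cover_of_Eaf => //; rewrite /Eaf Eb.
Qed.

End AffineCovers.

(** * The Weyl group *)

Section Weyl.
Context {R : realType} {n : nat} (D : root_datum R n).
Local Notation V := 'cV[R]_n.
Local Notation ht := (height D).
Local Notation e := (min_level D).
Local Notation h := (coheight D).
Implicit Types (a b v u : V) (w x y : 'M[R]_n) (i j : 'I_n) (s t : seq 'I_n).

Lemma word_nil : word D [::] = 1%:M.
Proof. by rewrite /word big_nil. Qed.

Lemma word_cons i s : word D (i :: s) = refl (simple D i) *m word D s.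
Proof. by rewrite /word big_cons. Qed.

Lemma word_cat s t : word D (s ++ t) = word D s *m word D t.
Proof.
elim: s => [|i s IH]; first by rewrite word_nil mul1mx.
by rewrite cat_cons !word_cons IH mulmxA.
Qed.

Lemma word_rcons s i : word D (rcons s i) = word D s *m refl (simple D i).
Proof. by rewrite -cats1 word_cat word_cons word_nil mulmx1. Qed.

Lemma word_rev s : word D (rev s) = (word D s)^T.
Proof.
elim: s => [|i s IH]; first by rewrite word_nil trmx1.
by rewrite rev_cons word_rcons word_cons trmx_mul refl_tr IH.
Qed.

Lemma permutes_word s : permutes D (word D s).
Proof.
elim: s => [|i s IH]; first by rewrite word_nil; apply: permutes1.
by rewrite word_cons; apply: permutes_mul => //; apply/permutes_refl/simple_root.
Qed.

Lemma weyl_permutes w : weyl D w -> permutes D w.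
Proof. by case=> s ->; apply: permutes_word. Qed.

Lemma weyl_root w a : weyl D w -> a \in roots D -> w *m a \in roots D.
Proof. by move=> /weyl_permutes[_ p] /p. Qed.

Lemma weyl_orth w : weyl D w -> orthogonal w.
Proof. by move=> /weyl_permutes[]. Qed.

Lemma weyl1 : weyl D 1%:M.
Proof. by exists [::]; rewrite word_nil. Qed.

Lemma weyl_mul w1 w2 : weyl D w1 -> weyl D w2 -> weyl D (w1 *m w2).
Proof. by move=> [s ->] [t ->]; exists (s ++ t); rewrite word_cat. Qed.

Lemma weyl_tr w : weyl D w -> weyl D w^T.
Proof. by move=> [s ->]; exists (rev s); rewrite word_rev. Qed.

Lemma weyl_refl_simple i : weyl D (refl (simple D i)).
Proof. by exists [:: i]; rewrite word_cons word_nil mulmx1. Qed.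

(** Conjugation by a simple reflection pairing positively with the root lowers its height. *)
Lemma weyl_refl a : a \in roots D -> weyl D (refl a).
Proof.
suff H (N : nat) b : b \in roots D -> 0 < ht b -> ht b <= N%:R -> weyl D (refl b).
  have H' b : b \in roots D -> 0 < ht b -> weyl D (refl b).
    by move=> bD hb; apply: (H (Num.truncn (ht b)).+1) => //; rewrite ltW // truncnS_gt.
  move=> aD; have [ha|ha] := boolP (0 < ht a); first exact: H'.
  by rewrite -[a]opprK reflN; apply: H'; rewrite ?rootN // htN oppr_gt0 ht_lt0.
elim: N b => [|N IH] b bD hb leN; first by lra.
have [i ib] := positive_simple_pair bD hb.
have [->|bi] := pselect (b = simple D i); first exact: weyl_refl_simple.
set c := refl (simple D i) *m b.
have cD : c \in roots D by rewrite roots_refl ?simple_root.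
have -> : refl b = refl (simple D i) *m refl c *m refl (simple D i).
  rewrite -{2}(refl_tr (simple D i)) -refl_orth; last exact: orth_refl.
  by rewrite /c reflK.
apply: weyl_mul (weyl_refl_simple i); apply: weyl_mul (weyl_refl_simple i) _.
apply: IH => //; first exact: refl_simple_pos.
rewrite /c refl_mul htB htZ ht_simple.
have : 1 <= pair (simple D i) b.
  by apply: int_gt0_ge1; rewrite ?pair_gt0 // (roots_int (simple_root D i) bD).
by move: leN; rewrite -natr1; lra.
Qed.

(** The dropped letter is the one at which the image of [simple D i] turns negative: by
    [refl_simple_pos] that image is then the simple root of the letter. *)
Lemma exchange s i : ht (word D s *m simple D i) < 0 ->
  exists2 t, (size t).+1 = size s & word D s *m refl (simple D i) = word D t.
Proof.
elim: s => [|j s IH]; first by rewrite word_nil mul1mx ht_simple; lra.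
rewrite word_cons -mulmxA => hneg.
have wD : word D s *m simple D i \in roots D.
  by apply: weyl_root (simple_root D i); exists s.
have [hs|hs] := boolP (0 < ht (word D s *m simple D i)).
  have [E|E] := pselect (word D s *m simple D i = simple D j).
    exists s => //; rewrite -E refl_orth; last exact: (permutes_word s).1.
    rewrite -!mulmxA [_^T *m _]mulmxA (permutes_word s).1 mul1mx.
    by rewrite refl_sqr mulmx1.
  by move: (refl_simple_pos wD hs E); lra.
rewrite -ht_lt0 // in hs; have [t ts Et] := IH hs.
exists (j :: t); first by rewrite /= ts.
by rewrite word_cons -Et !mulmxA.
Qed.

(** By [exchange] any nonempty word for [w] can be replaced by one two letters shorter. *)
Lemma weyl_eq1 w : weyl D w -> (forall i, 0 < ht (w *m simple D i)) -> w = 1%:M.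
Proof.
move=> [s ->]; have [N] := ubnP (size s).
elim: N s => // N IH s; case/lastP: s => [|s i]; first by rewrite word_nil.
rewrite size_rcons ltnS => sN pos.
have := pos i; rewrite word_rcons -mulmxA reflxx mulmxN htN oppr_gt0.
move/exchange => [t ts E]; rewrite E.
by apply: IH => [|j]; [lia|rewrite -E -word_rcons].
Qed.

(** [Nv] as a natural number. At [w *m h] it counts the positive roots that [w] makes negative,
    hence the length of [w]. *)
Definition nneg v : nat := count (fun a => (0 < dot a v) && (ht a < 0)) (roots D).

Lemma NvE v : Nv D v = (nneg v)%:R.
Proof.
rewrite /Nv /nneg -sum1_count natr_sum big_mkcond [RHS]big_mkcond.
apply: eq_bigr => a _; rewrite /min_level.
by case: (0 < dot a v) => //=; case: (ht a < 0).
Qed.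

Lemma Nv_dominant v : (forall i, 0 <= dot (simple D i) v) -> Nv D v = 0.
Proof.
move=> dv; rewrite /Nv big_seq_cond big1 // => a /andP[aD av].
apply: e_pos; rewrite -[_ < _]negbK -ht_lt0 //; apply/negP => ha.
have := dominant_pos_dot dv (a := - a); rewrite rootN htN oppr_gt0 => /(_ aD ha).
by rewrite dotNl; lra.
Qed.

Lemma Nv_simple i v :
  Nv D (refl (simple D i) *m v) = Nv D v + Num.sg (dot (simple D i) v).
Proof.
by rewrite Nv_asimple ?e_pos ?ht_simple // ?mul0r ?subr0 //; apply: asimple_simple.
Qed.

Lemma dot_simple_coheight i : dot (simple D i) h = 1.
Proof. exact: ht_simple. Qed.

Lemma nneg_word s : (nneg (word D s *m h) <= size s)%N.
Proof.
rewrite -(ler_nat R) -NvE; elim: s => [|i s IH].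
  rewrite word_nil mul1mx Nv_dominant // => i.
  by rewrite dot_simple_coheight.
rewrite word_cons -mulmxA Nv_simple /= -natr1 lerD //.
have [H|H|H] := ltgtP (dot (simple D i) (word D s *m h)) 0.
- by rewrite ltr0_sg //; lra.
- by rewrite gtr0_sg.
- by rewrite H sgr0.
Qed.

Lemma dot_weylC w a v : weyl D w -> dot a (w *m v) = dot (w^T *m a) v.
Proof.
move=> ww; rewrite -[a in LHS]mul1mx -(orthV (weyl_orth ww)) -mulmxA.
by rewrite dot_orth //; apply: weyl_orth.
Qed.

(** While some simple root is negative at [w *m h], its reflection lowers the count by one and
    supplies a letter. When none is, [w^T] keeps all simple roots positive and is 1. *)
Lemma reduced_word w : weyl D w -> exists2 s, w = word D s & size s = nneg (w *m h).
Proof.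
have [N] := ubnP (nneg (w *m h)); elim: N w => // N IH w; rewrite ltnS => wN ww.
have [[i Hi]|H] := pselect (exists i, dot (simple D i) (w *m h) < 0).
  set w' := refl (simple D i) *m w.
  have ww' : weyl D w' by apply: weyl_mul ww; apply: weyl_refl_simple.
  have E : (nneg (w' *m h)).+1 = nneg (w *m h).
    apply/eqP; rewrite -(eqr_nat R) -natr1 -!NvE -mulmxA Nv_simple ltr0_sg //.
    by apply/eqP; ring.
  have [||s Es ss] := IH w' => //; first by rewrite E.
  exists (i :: s); last by rewrite /= ss.
  by rewrite word_cons -Es /w' mulmxA refl_sqr mul1mx.
have N0 : nneg (w *m h) = 0%N.
  apply/eqP; rewrite -(eqr_nat R) -NvE Nv_dominant // => i.
  by rewrite leNgt; apply/negP => Hi; apply: H; exists i.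
exists [::]; last by rewrite N0.
rewrite word_nil -[w]trmxK; rewrite (_ : w^T = 1%:M) ?trmx1 //.
apply: weyl_eq1 => [|i]; first exact: weyl_tr.
have wD : w^T *m simple D i \in roots D.
  by apply: weyl_root (weyl_tr ww) (simple_root D i).
rewrite -[_ < _]negbK -ht_lt0 //; apply/negP => hneg; apply: H; exists i.
by rewrite dot_weylC.
Qed.

Lemma ellE w : weyl D w -> ell D w = nneg (w *m h).
Proof.
move=> ww; have [s Es ss] := reduced_word ww.
rewrite /ell; case: xgetP => [l _ [[t Et tl] Hl]|/(_ (nneg (w *m h)))].
  apply/eqP; rewrite eqn_leq -{1}ss Hl //= -tl {1}Et; exact: nneg_word.
case; split; first by exists s.
by move=> t ->; apply: nneg_word.
Qed.

End Weyl.

(** * The parabolic quantum Bruhat graph *)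

Section Parabolic.
Context {R : realType} {n : nat} (D : root_datum R n) (lam : 'cV[R]_n).
Hypothesis lam_dominant : dominant D lam.
Local Notation V := 'cV[R]_n.
Local Notation ht := (height D).
Local Notation e := (min_level D).
Local Notation h := (coheight D).
Local Notation J := (stab_index D lam).
Implicit Types (a b v : V) (u w x y : 'M[R]_n) (i j : 'I_n) (s t : seq 'I_n).

Lemma dot_simple_lam i : 0 <= dot (simple D i) lam.
Proof. by rewrite -pair_ge0. Qed.

Lemma dot_pos_lam a : a \in roots D -> 0 < ht a -> 0 <= dot a lam.
Proof. exact: dominant_pos_dot dot_simple_lam. Qed.

Lemma ht_of_dot_lam a : a \in roots D -> 0 < dot a lam -> 0 < ht a.
Proof.
move=> aD al; rewrite -[_ < _]negbK -ht_lt0 //; apply/negP => ha.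
have := @dot_pos_lam (- a); rewrite rootN htN oppr_gt0 dotNl => /(_ aD ha); lra.
Qed.

(** For a positive root [dot a lam] is a sum of nonnegative terms, one for each simple root; if it
    vanishes, so does every coordinate outside [J]. *)
Lemma positive_root_inE a : a \in roots D ->
  positive_root_in D J a <-> 0 < ht a /\ dot a lam = 0.
Proof.
move=> aD; split=> [[pa [c E]]|[ha a0]].
  split; first exact: positive_ht_gt0.
  rewrite E dot_suml big1 // => j; rewrite /stab_index pair_eq0 => /eqP H.
  by rewrite dotZl H mulr0.
split; first exact/positive_rootE.
exists (fun i => dot a (coweight D i)).
rewrite [LHS](comb_coweight D) [RHS]big_mkcond; apply: eq_bigr => i _.
case: ifPn => //; rewrite /stab_index pair_eq0 => li.
move: a0; rewrite {1}[a](comb_coweight D) dot_suml.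
move=> /psumr_eq0P H.
have /eqP : dot (dot a (coweight D i) *: simple D i) lam = 0.
  by apply: H => // k _; rewrite dotZl mulr_ge0 ?dot_simple_lam ?positive_coweight_ge0.
by rewrite dotZl mulf_eq0 (negPf li) orbF => /eqP ->; rewrite scale0r.
Qed.

Lemma weyl_in_weyl u : weyl_in D J u -> weyl D u.
Proof. by move=> [s _ ->]; exists s. Qed.

Lemma weyl_in_mul u1 u2 : weyl_in D J u1 -> weyl_in D J u2 -> weyl_in D J (u1 *m u2).
Proof.
move=> [s As ->] [t At ->]; exists (s ++ t); last by rewrite word_cat.
by rewrite all_cat As.
Qed.

Lemma weyl_in1 : weyl_in D J 1%:M.
Proof. by exists [::]; rewrite ?word_nil. Qed.

Lemma weyl_in_lam u : weyl_in D J u -> u *m lam = lam.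
Proof.
move=> [s + ->]; elim: s => [|i s IH]; first by rewrite word_nil mul1mx.
move=> /= /andP[/eqP Ji As]; rewrite word_cons -mulmxA IH // refl_mul Ji.
by rewrite scale0r subr0.
Qed.

Definition positive_on_J x : Prop :=
  forall a, a \in roots D -> 0 < ht a -> dot a lam = 0 -> 0 < ht (x *m a).

(** The count at [w *m lam] misses exactly the roots made negative by [w] that are orthogonal to
    [lam]; [positive_on_J] says that there are none. *)
Lemma nneg_lam_le w : weyl D w -> (nneg D (w *m lam) <= nneg D (w *m h))%N.
Proof.
move=> ww; rewrite /nneg -!size_filter; apply: uniq_leq_size.
  by rewrite filter_uniq ?roots_uniq.
move=> a; rewrite !mem_filter => /andP[/andP[al ->] aD]; rewrite aD !andbT.
move: al; rewrite !(dot_weylC _ _ ww); apply: ht_of_dot_lam.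
by apply: weyl_root => //; apply: weyl_tr.
Qed.

Lemma nneg_lam x : weyl D x -> positive_on_J x -> nneg D (x *m lam) = nneg D (x *m h).
Proof.
move=> wx px; rewrite /nneg; apply: eq_in_count => a aD.
case: (boolP (ht a < 0)); rewrite ?andbF // => ha; rewrite !andbT.
have wa : x^T *m a \in roots D by apply: weyl_root => //; apply: weyl_tr.
apply/idP/idP; rewrite !(dot_weylC _ _ wx) => Ha; first exact: ht_of_dot_lam.
rewrite lt_def dot_pos_lam // andbT; apply/eqP => a0.
have := px _ wa Ha a0; rewrite mulmxA (orthV (weyl_orth wx)) mul1mx; lra.
Qed.

(** If [x] made a simple root of [J] negative, [exchange] would shorten it within its coset.
    Conversely, for [x] positive on Phi_J^+ the length is the count at [x *m lam], which is constant
    on the coset and bounds all lengths there from below. *)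
Lemma min_repsP x : min_reps D J x <-> weyl D x /\ positive_on_J x.
Proof.
split=> [[wx mx]|[wx px]]; last first.
  split=> // u wu; have wu' := weyl_in_weyl wu.
  rewrite !ellE //; last exact: weyl_mul.
  rewrite -nneg_lam // -{1}(weyl_in_lam wu) mulmxA.
  by apply: nneg_lam_le; apply: weyl_mul.
split=> // a aD ha a0.
have sJ j : J j -> 0 < ht (x *m simple D j).
  move=> Jj; have xj : x *m simple D j \in roots D by apply: weyl_root (simple_root D j).
  rewrite -[_ < _]negbK -ht_lt0 //; apply/negP => hneg.
  have [s Es ss] := reduced_word wx.
  move: hneg; rewrite Es => /exchange[t ts Et].
  have := mx (refl (simple D j)).
  rewrite !ellE //; last by apply: weyl_mul => //; apply: weyl_refl_simple.
  rewrite -ss Es Et -ts ltnNge nneg_word => H.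
  suff : false by []; apply: H.
  by exists [:: j]; rewrite /= ?Jj // word_cons word_nil mulmx1.
have [_ [c E]] : positive_root_in D J a by apply/positive_root_inE.
have xa : x *m a \in roots D by apply: weyl_root.
rewrite lt_def root_ht_neq0 //= [a](comb_coweight D) mulmx_sumr /height dot_suml.
apply: sumr_ge0 => i _; rewrite -scalemxAr dotZl.
case: (boolP (J i)) => Ji.
  by rewrite mulr_ge0 ?positive_coweight_ge0 // ltW //; apply: sJ.
rewrite E dot_suml big1 ?mul0r // => j Jj; rewrite dotZl dot_simple_coweight.
by case: eqP => [ji|]; rewrite ?mulr0 //; rewrite -ji Jj in Ji.
Qed.

(** The element [y^T *m x] fixes [lam] and keeps simple roots positive: those not orthogonal to
    [lam] by dominance, the others because [x] and [y] are both positive on Phi_J^+. With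
    [floor_inP] this identifies W^J with the orbit of [lam]. *)
Lemma min_reps_inj x y : min_reps D J x -> min_reps D J y -> x *m lam = y *m lam -> x = y.
Proof.
move=> /min_repsP[wx px] /min_repsP[wy py] E.
have E1 : y^T *m x = 1%:M.
  apply: (@weyl_eq1 _ _ D) => [|i]; first by apply: weyl_mul wx; apply: weyl_tr.
  set b := simple D i; have bD : b \in roots D := simple_root D i.
  have hb : 0 < ht b by rewrite ht_simple.
  have xb : x *m b \in roots D by apply: weyl_root.
  set c := y^T *m x *m b.
  have cE : c = y^T *m (x *m b) by rewrite /c mulmxA.
  have cD : c \in roots D by rewrite cE; apply: weyl_root => //; apply: weyl_tr.
  have cl : dot c lam = dot b lam.
    by rewrite cE -(dot_weylC _ _ wy) -E dot_orth //; apply: (weyl_orth wx).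
  have := dot_pos_lam bD hb; rewrite le_eqVlt => /orP[/eqP b0|b0]; last first.
    by apply: ht_of_dot_lam; rewrite ?cl.
  rewrite -[_ < _]negbK -ht_lt0 //; apply/negP => hc.
  have := py (- c); rewrite rootN htN oppr_gt0 dotNl cl -b0 oppr0 => /(_ cD hc erefl).
  rewrite mulmxN htN cE (mulmxA y) (orthV (weyl_orth wy)) mul1mx.
  by have := px _ bD hb (esym b0); lra.
by rewrite -[x]mul1mx -(orthV (weyl_orth wy)) -mulmxA E1 mulmx1.
Qed.

Lemma floor_inP w : weyl D w ->
  min_reps D J (floor_in D J w) /\ floor_in D J w *m lam = w *m lam.
Proof.
move=> ww; rewrite /floor_in; case: xgetP => [x _ [mx [u wu E]]|H].
  by split; [exact: mx|rewrite E -mulmxA weyl_in_lam].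
exfalso.
pose P l := `[< exists2 u, weyl_in D J u & ell D (w *m u) = l >].
have exP : exists l, P l.
  exists (ell D (w *m 1%:M)); apply/asboolP; exists 1%:M => //; exact: weyl_in1.
have [l /asboolP[u wu ul] lmin] := ex_minnP exP.
apply: (H (w *m u)); split; last by exists u.
split=> [|u' wu']; first by apply: weyl_mul => //; apply: weyl_in_weyl.
rewrite ul -mulmxA; apply: lmin; apply/asboolP; exists (u *m u') => //.
exact: weyl_in_mul.
Qed.

Lemma ell_min_reps x : min_reps D J x -> ell D x = nneg D (x *m lam).
Proof. by move=> /min_repsP[wx px]; rewrite ellE // nneg_lam. Qed.

Lemma floor_in_eq w y : weyl D w -> min_reps D J y -> w *m lam = y *m lam ->
  floor_in D J w = y.
Proof. by move=> /floor_inP[m1 E1] m2 E2; apply: min_reps_inj => //; rewrite E1. Qed.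

End Parabolic.

(** * Edges of the quantum Bruhat graph as reflections with E = 1 *)

Section Edges.
Context {R : realType} {n : nat} (D : root_datum R n).
Local Notation V := 'cV[R]_n.
Local Notation ht := (height D).
Local Notation e := (min_level D).

(* Symmetrizing under a |-> - a and a |-> r_g a, the length difference becomes a
   sum of nonnegative terms in which g and - g contribute 2 each. *)
Lemma Nv_refl_eq1 (g v z : V) : g \in roots D -> 0 < ht g -> 0 < dot g v ->
  Nv D (refl g *m v) - Nv D v = 1 ->
  z \in roots D -> 0 < ht z -> dot z v = 0 -> 0 < ht (refl g *m z).
Proof.
move=> gD hg gv N1 zD hz zv.
pose p a : R := (0 < dot a v)%R%:R.
pose d a := e (refl g *m a) - e a.
have pg := permutes_refl gD.
have S1 : 1 = \sum_(a <- roots D) p a * d a.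
  rewrite -N1 {1}/Nv (reindex_roots _ _ pg) /Nv.
  under eq_bigl => a do rewrite dot_refl.
  rewrite -sumrB big_mkcond; apply: eq_bigr => a _.
  by rewrite /p /d; case: (0 < dot a v); rewrite ?mul1r ?mul0r.
have pN : permutes D (-1)%:M.
  split=> [|a aD]; last by rewrite mul_scalar_mx scaleN1r rootN.
  by rewrite /orthogonal tr_scalar_mx mul_scalar_mx scale_scalar_mx mulrNN mulr1.
have dN a : a \in roots D -> d (- a) = - d a.
  by move=> aD; rewrite /d mulmxN !eN ?roots_refl //; ring.
have dr a : d (refl g *m a) = - d a by rewrite /d reflK; ring.
have S2 : 1 = - \sum_(a <- roots D) p (- a) * d a.
  rewrite {1}S1 (reindex_roots _ _ pN) -sumrN !big_seq; apply: eq_bigr => a aD.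
  by rewrite mul_scalar_mx scaleN1r dN // mulrN.
have S3 : 1 = - \sum_(a <- roots D) p (refl g *m a) * d a.
  rewrite {1}S1 (reindex_roots _ _ pg) -sumrN; apply: eq_bigr => a _.
  by rewrite dr mulrN.
have S4 : 1 = \sum_(a <- roots D) p (- (refl g *m a)) * d a.
  rewrite {1}S2 (reindex_roots _ _ pg) -sumrN; apply: eq_bigr => a _.
  by rewrite dr mulrN opprK.
have pE a : p a - p (- a) = Num.sg (dot a v).
  by rewrite /p dotNl oppr_gt0 sub_indicator_sg.
pose T a := (Num.sg (dot a v) - Num.sg (dot (refl g *m a) v)) * d a.
have S : 4 = \sum_(a <- roots D) T a.
  rewrite /T; under eq_bigr => a _ do rewrite -!pE opprB addrA.
  under eq_bigr => a _ do rewrite mulrBl mulrDl mulrBl.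
  rewrite sumrB big_split sumrB /= -S1 -S4.
  move: S2 S3; lra.
have dcase a : a \in roots D -> d a <> 0 ->
    (0 < dot g a /\ d a = 1) \/ (dot g a < 0 /\ d a = -1).
  move=> aD; rewrite /d; have rD : refl g *m a \in roots D by apply: roots_refl.
  have hr : ht (refl g *m a) = ht a - pair g a * ht g by rewrite refl_mul htB htZ.
  have [ha|ha] := boolP (0 < ht a); have [hra|hra] := boolP (0 < ht (refl g *m a)).
  - by rewrite !e_pos // subrr.
  - rewrite -ht_lt0 // in hra; rewrite e_neg // e_pos // subr0 => _; left; split=> //.
    by rewrite -pair_gt0; move: hra; rewrite hr; nra.
  - rewrite -ht_lt0 // in ha; rewrite e_pos // e_neg // sub0r => _; right; split=> //.
    by rewrite -pair_lt0; move: hra; rewrite hr; nra.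
  - by rewrite !e_neg ?ht_lt0 // subrr.
have T0 a : a \in roots D -> 0 <= T a.
  move=> aD; have [d0|/eqP d0] := eqVneq (d a) 0; first by rewrite /T d0 mulr0.
  rewrite /T refl_mul dotBl dotZl.
  case: (dcase _ aD d0) => -[ga0 ->].
    have ga : 0 < pair g a by rewrite pair_gt0.
    by rewrite mulr1 subr_ge0 le_sg // gerBl mulr_ge0 // ltW.
  have ga : pair g a < 0 by rewrite pair_lt0.
  by rewrite mulrN1 opprB subr_ge0 le_sg // lerBrDr gerDl mulr_le0_ge0 // ltW.
(* If [refl g *m z] were negative, [z] would add 1 to the 4 already contributed by [g] and [- g],
   while the whole sum is 4. *)
rewrite -[_ < _]negbK -ht_lt0 ?roots_refl //; apply/negP => hneg.
have dz : d z = 1 by rewrite /d e_neg // e_pos // subr0.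
have gz : 0 < dot g z.
  by case: (dcase z zD) => [|[]//|[_]]; rewrite dz //; lra.
have Tz : T z = 1.
  rewrite /T dz mulr1 zv sgr0 sub0r refl_mul dotBl dotZl zv sub0r sgrN opprK.
  by rewrite gtr0_sg // mulr_gt0 // pair_gt0.
have dg : d g = 1.
  by rewrite /d reflxx e_neg ?htN ?oppr_lt0 // e_pos // subr0.
have Tg : T g = 2.
  by rewrite /T dg reflxx dotNl sgrN gtr0_sg // mulr1 opprK.
have TNg : T (- g) = 2.
  by rewrite /T dN // dg mulmxN reflxx opprK dotNl sgrN gtr0_sg // mulrN1 opprB opprK.
have gNg : - g != g.
  by apply/eqP => /(congr1 ht); rewrite htN; lra.
have zg : z != g by apply/eqP => E; move: gv; rewrite -E zv ltxx.
have zNg : z != - g by apply/eqP => E; move: gv; rewrite -[g]opprK -E dotNl zv oppr0 ltxx.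
move: S; rewrite (bigD1_seq g) ?roots_uniq //= Tg -big_filter.
rewrite (bigD1_seq (- g)) ?filter_uniq ?roots_uniq //=; last first.
  by rewrite mem_filter gNg rootN.
rewrite TNg -big_filter (bigD1_seq z) ?filter_uniq ?roots_uniq //=; last first.
  by rewrite !mem_filter zNg zg.
rewrite Tz big_seq_cond => S.
suff : 0 <= \sum_(i <- [seq i <- [seq i <- roots D | i != g] | i != - g] |
     (i \in [seq i <- [seq i <- roots D | i != g] | i != - g]) && (i != z)) T i by lra.
by apply: sumr_ge0 => a; rewrite !mem_filter => /andP[/and3P[_ _ aD] _]; apply: T0.
Qed.

Context (lam : V).
Hypothesis lam_dominant : dominant D lam.
Local Notation J := (stab_index D lam).

(** By dominance the roots pairing positively with [lam] are those of Phi^+ outside Phi_J^+. *)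
Lemma Pv_lam : Pv D lam = 2 *: rho D - 2 *: rho_in D J.
Proof.
rewrite /rho /rho_in !scalerA divff ?pnatr_eq0 // !scale1r /Pv.
rewrite [LHS]big_mkcond [X in _ = X - _]big_mkcond [X in _ = _ - X]big_mkcond.
rewrite -sumrB !big_seq; apply: eq_bigr => a aD.
have [al|al] := boolP (0 < dot a lam).
  have ha := ht_of_dot_lam lam_dominant aD al.
  rewrite asboolT; last exact/positive_rootE.
  rewrite asboolF ?subr0 //; move/(positive_root_inE lam_dominant aD) => [_ a0].
  by rewrite a0 ltxx in al.
have [ha|ha] := boolP (0 < ht a).
  have a0 : dot a lam = 0.
    by apply/eqP; rewrite eq_le (dot_pos_lam lam_dominant) // leNgt al.
  rewrite asboolT; last exact/positive_rootE.
  by rewrite asboolT ?subrr //; apply/positive_root_inE.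
rewrite asboolF; last by move/positive_ht_gt0/(negP ha).
by rewrite asboolF ?subr0 // => -[/positive_ht_gt0/(negP ha)].
Qed.

Lemma Ev_ge1 g v k : g \in roots D -> 0 < dot g v -> 1 <= Ev D v g (e g + k%:R).
Proof.
move=> gD gv; apply: (@Eaf_ge1 R n D (g, _) (v, 0)); last by rewrite /af_pair pair_gt0.
by split=> //; exists k.
Qed.

(** This is the bound on E with the regular vector [coheight D] in the place of [lam], where [Nv] is
    the full length and the level is 0. *)
Lemma ell_refl_gt x a : weyl D x -> a \in roots D -> 0 < ht a -> ht (x *m a) < 0 ->
  (ell D (x *m refl a) < ell D x)%N.
Proof.
move=> wx aD ha hxa.
have xa : x *m a \in roots D by apply: weyl_root.
have ox := weyl_orth wx.
set g := - (x *m a); have gD : g \in roots D by rewrite rootN.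
have hg : 0 < ht g by rewrite htN oppr_gt0.
have xr : x *m refl a = refl g *m x.
  by rewrite reflN refl_orth // -mulmxA ox mulmx1.
have wxr : weyl D (x *m refl a) by apply: weyl_mul => //; apply: weyl_refl.
rewrite !ellE // -(ltr_nat R) -!NvE.
have := @Ev_ge1 g (x *m refl a *m coheight D) 0 gD.
rewrite /Ev e_pos // addr0 mul0r addr0 xr -mulmxA reflK.
rewrite -dot_reflC reflxx opprK dot_orth // => /(_ ha); lra.
Qed.

(** The sign of [x *m a] selects the kind of edge: if negative, a Bruhat edge would raise the length
    against [ell_refl_gt]; if positive, a quantum edge would have E = 1 at level 1, too high a
    level. *)
Lemma edgeP x a : min_reps D J x -> a \in roots D -> 0 < dot a lam ->
  bruhat_edge D x a \/ quantum_edge D J x a <->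
  Ev D (x *m lam) (x *m a) (e (x *m a)) = 1.
Proof.
move=> mx aD al; have [wx px] := (min_repsP lam_dominant x).1 mx.
have ha := ht_of_dot_lam lam_dominant aD al.
have ox := weyl_orth wx.
set g := x *m a; have gD : g \in roots D by apply: weyl_root.
have gv : 0 < dot g (x *m lam) by rewrite dot_orth.
have wxr : weyl D (x *m refl a) by apply: weyl_mul => //; apply: weyl_refl.
have xr v : x *m refl a *m v = refl g *m (x *m v).
  by rewrite refl_orth // -!mulmxA (mulmxA x^T) ox mul1mx.
have [mf fl] := floor_inP lam wxr.
have Efl : (ell D (floor_in D J (x *m refl a)))%:R = Nv D (refl g *m (x *m lam)).
  by rewrite (ell_min_reps lam_dominant mf) fl -NvE xr.
have Ex : (ell D x)%:R = Nv D (x *m lam) by rewrite (ell_min_reps lam_dominant mx) -NvE.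
have qE : quantum_edge D J x a <-> Ev D (x *m lam) g 1 = 1.
  rewrite /quantum_edge -Pv_lam Efl Ex /Ev Pv_perm ?pair_orth //; last first.
    exact: weyl_permutes.
  by split; lra.
have pP : 0 < pair g (Pv D (x *m lam)) by rewrite pair_gt0 Pv_pos.
have [hg|hg] := boolP (0 < ht g); last first.
  rewrite -ht_lt0 // in hg; rewrite e_neg // -qE.
  split=> [[|//]|]; last by right.
  by have := ell_refl_gt wx aD ha hg; rewrite /bruhat_edge; lia.
have Eg := @Ev_ge1 g (x *m lam) 0 gD gv.
rewrite addr0 in Eg.
rewrite e_pos // in Eg *.
have NQ : ~ quantum_edge D J x a by rewrite qE; move: Eg; rewrite /Ev; lra.
rewrite /bruhat_edge; split=> [[E|//]|E].
  apply/eqP; rewrite eq_le Eg andbT /Ev mul0r addr0 -Efl -Ex.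
  (* A Bruhat edge speaks of the length of [x *m refl a], while E sees only that of its minimal
     representative. Here an upper bound suffices, E being at least 1. *)
  have : (ell D (floor_in D J (x *m refl a)) <= ell D (x *m refl a))%N.
    rewrite (ell_min_reps lam_dominant mf) fl ellE //.
    exact: nneg_lam_le.
  by rewrite E -(ler_nat R) -natr1; lra.
left; move: E; rewrite /Ev mul0r addr0 => E.
(* In this direction the two lengths must agree: [Nv_refl_eq1] shows that [x *m refl a] is already
   minimal in its coset. *)
have pxr : positive_on_J D lam (x *m refl a).
  move=> b bD hb b0; rewrite xr; apply: (Nv_refl_eq1 gD hg gv E).
  - exact: weyl_root.
  - exact: px.
  - by rewrite dot_orth.
apply/eqP; rewrite -(eqr_nat R) -natr1 Ex ellE //.
by rewrite -(nneg_lam lam_dominant wxr pxr) -NvE xr; apply/eqP; lra.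
Qed.

End Edges.

(** * Paths *)

Section Lifts.
Context {R : realType} {n : nat} (D : root_datum R n) (lam : 'cV[R]_n).
Hypothesis lam_dominant : dominant D lam.
Local Notation V := 'cV[R]_n.
Local Notation Vaf := (@af_space R n).
Local Notation J := (stab_index D lam).
Local Notation orbit := (af_orbit D lam).
Implicit Types (mu nu beta : Vaf) (x y : 'M[R]_n) (b : rat).

Lemma cl_refl beta mu : cl (af_refl beta mu) = refl beta.1 *m cl mu.
Proof. by rewrite /cl af_reflE. Qed.

Lemma orbit_cl mu : orbit mu -> exists2 w, weyl D w & cl mu = w *m lam.
Proof.
move=> [f [s Hs Hf] <-]; rewrite Hf.
elim: s Hs {Hf f} => [|beta s IH] Hs.
  by exists 1%:M; rewrite ?mul1mx //; apply: weyl1.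
have [|w ww E] := IH; first by move=> g gs; apply: Hs; rewrite inE gs orbT.
have [bD _] : aroot D beta by apply/af_positive_rootE/Hs/mem_head.
exists (refl beta.1 *m w); first by apply: weyl_mul => //; apply: weyl_refl.
by rewrite -mulmxA -E; apply: cl_refl.
Qed.

Lemma weyl_orbit w : weyl D w -> exists2 mu, orbit mu & cl mu = w *m lam.
Proof.
move=> [s ->]; elim: s => [|i s [mu om E]].
  exists (lam, 0); last by rewrite word_nil mul1mx.
  by exists id => //; exists [::].
exists (af_refl (simple D i, 0) mu).
  apply: orbit_refl => //; split; first exact: simple_root.
  by exists 0%N; rewrite /= e_pos ?addr0 // ht_simple.
by rewrite word_cons -mulmxA -E cl_refl.
Qed.

Lemma exists_rep mu : orbit mu -> exists2 x, min_reps D J x & cl mu = x *m lam.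
Proof.
move=> /orbit_cl[w ww E]; have [mf fl] := floor_inP lam ww.
by exists (floor_in D J w) => //; rewrite fl.
Qed.

Definition rep mu : 'M[R]_n := xget 0 [set x | min_reps D J x /\ cl mu = x *m lam].

Lemma repP mu : orbit mu -> min_reps D J (rep mu) /\ cl mu = rep mu *m lam.
Proof.
move=> /exists_rep[x mx E]; rewrite /rep; case: xgetP => [y _ //|/(_ x)].
by case.
Qed.

Lemma dot_lam_gt0E a : a \in roots D ->
  positive_root D a /\ ~ positive_root_in D J a <-> 0 < dot a lam.
Proof.
move=> aD; split=> [[/(positive_rootE aD) ha H]|al].
  rewrite lt_def (dot_pos_lam lam_dominant) // andbT; apply/eqP => a0; apply: H.
  exact/positive_root_inE.
split; first exact/positive_rootE/(ht_of_dot_lam lam_dominant).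
by move=> /(positive_root_inE lam_dominant aD) [_ a0]; rewrite a0 ltxx in al.
Qed.

Lemma floor_in_refl x y a : weyl D x -> min_reps D J y -> a \in roots D ->
  refl (x *m a) *m (x *m lam) = y *m lam -> floor_in D J (x *m refl a) = y.
Proof.
move=> wx my aD E; apply: floor_in_eq => //.
  by apply: weyl_mul => //; apply: weyl_refl.
rewrite -E refl_orth; last exact: weyl_orth wx.
by rewrite -!mulmxA (mulmxA x^T) (weyl_orth wx) mul1mx.
Qed.

(** The label of the edge is the affine root's finite part moved back by [x^T]. Its pairing with
    [lam] is that of the affine root with mu, so positivity and integrality carry over. *)
Lemma chain_step_edge b nu mu : chain_step D lam b nu mu ->
  qb_edge D lam b (rep mu) (rep nu).
Proof.
move=> [C [beta [/af_positive_rootE rb Enu bint]]].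
have [om on] := af_lt_orbit C.1.
have [mx Ex] := repP om; have [my Ey] := repP on.
rewrite Enu in C; have [p Eb E1] := (coverP rb om).1 C.
have [wx _] := (min_repsP lam_dominant _).1 mx.
set x := rep mu in mx Ex wx *; have [bD _] := rb.
split=> //; set a := x^T *m beta.1.
have aD : a \in roots D by apply: weyl_root => //; apply: weyl_tr.
have xa : x *m a = beta.1 by rewrite mulmxA (orthV (weyl_orth wx)) mul1mx.
have pE : pair a lam = af_pair beta mu.
  by rewrite /af_pair Ex -xa pair_orth //; apply: weyl_orth wx.
have al : 0 < dot a lam by rewrite -pair_gt0 pE.
exists a; split.
- exact/dot_lam_gt0E.
- apply/esym/floor_in_refl => //.
  by rewrite xa -Ex -Ey Enu cl_refl.
- by apply/(edgeP lam_dominant mx aD al); rewrite xa -Ex.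
- by rewrite pE.
Qed.

Lemma edge_chain_step b x y mu : qb_edge D lam b x y -> orbit mu ->
  cl mu = x *m lam -> exists nu,
  [/\ chain_step D lam b nu mu, min_reps D J y & cl nu = y *m lam].
Proof.
move=> [mx [a [pa Ey edge bint]]] om Ex.
have aD := pa.1.1; move/(dot_lam_gt0E aD): pa => al.
have [wx _] := (min_repsP lam_dominant _).1 mx.
have ox := weyl_orth wx.
have bD : x *m a \in roots D by apply: weyl_root.
have wxr : weyl D (x *m refl a) by apply: weyl_mul => //; apply: weyl_refl.
have [my fl] := floor_inP lam wxr; rewrite -Ey in my fl.
(* By [coverP] the minimal level is the only one at which the lifted step can be a cover. *)
set beta : Vaf := (x *m a, min_level D (x *m a)).
have rb : aroot D beta by split=> //; exists 0%N; rewrite addr0.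
have pE : af_pair beta mu = pair a lam by rewrite /af_pair Ex pair_orth.
exists (af_refl beta mu); split=> //; last first.
  by rewrite cl_refl Ex fl refl_orth // -!mulmxA (mulmxA x^T) ox mul1mx.
split.
  apply/coverP => //; split=> //; first by rewrite pE pair_gt0.
  by rewrite -/(cl mu) Ex; apply/(edgeP lam_dominant mx aD al).
by exists beta; split=> //; rewrite ?pE //; apply/af_positive_rootE.
Qed.

Local Notation qb_path b := (Relation_Operators.clos_refl_trans _ (qb_edge D lam b)).

Lemma b_chain_path b nu mu : b_chain D lam b nu mu -> qb_path b (rep mu) (rep nu).
Proof.
elim=> [nu' mu' H|nu'|a c d _ H1 _ H2].
- by apply: rt_step; apply: chain_step_edge.
- exact: rt_refl.
- exact: rt_trans H2 H1.
Qed.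

Lemma path_b_chain b x y mu : qb_path b x y -> min_reps D J x -> orbit mu ->
  cl mu = x *m lam -> exists nu,
  [/\ b_chain D lam b nu mu, orbit nu, min_reps D J y, cl nu = y *m lam
    & af_le D lam mu nu].
Proof.
move=> p; elim: p mu => {x y} [x y H|x|x y z _ IH1 _ IH2] mu mx om Ex.
- have [nu [cs my Ey]] := edge_chain_step H om Ex.
  have [_ on] := af_lt_orbit cs.1.1.
  by exists nu; split=> //; [apply: rt_step|right; apply: cs.1.1].
- by exists mu; split=> //; [apply: rt_refl|left].
- have [nu [c1 on my Ey l1]] := IH1 _ mx om Ex.
  have [kap [c2 ok mz Ez l2]] := IH2 _ my on Ey.
  exists kap; split=> //; first exact: rt_trans c2 c1.
  case: l1 => [->//|l1]; right; exact: af_lt_le_trans l2.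
Qed.

(** The lift is built from the last direction, placed anywhere above its projection, and each
    earlier one is reached by lifting a path upwards. Entry [k] of [c] belongs to the junction of
    directions [k] and [k.+1]. *)
Lemma lift_path_seq (xs : seq 'M[R]_n) (c : seq rat) :
  (forall w, w \in xs -> min_reps D J w) ->
  (forall k, (k.+1 < size xs)%N -> xs`_k <> xs`_k.+1 /\ qb_path c`_k xs`_k.+1 xs`_k) ->
  exists nus : seq Vaf,
  [/\ size nus = size xs, (forall mu, mu \in nus -> orbit mu),
      (forall k, (k < size xs)%N -> cl nus`_k = xs`_k *m lam)
    & forall k, (k.+1 < size xs)%N ->
        af_lt D lam nus`_k.+1 nus`_k /\ b_chain D lam c`_k nus`_k nus`_k.+1].
Proof.
elim: xs c => [|w xs IH] c mxs pxs; first by exists [::].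
have [||nus [sn on En cn]] := IH (behead c).
- by move=> x xx; apply: mxs; rewrite inE xx orbT.
- by move=> k kx; rewrite nth_behead; apply: (pxs k.+1).
have mw := mxs w (mem_head _ _).
case: xs IH mxs pxs sn En cn => [|w' xs] IH mxs pxs sn En cn.
  have [ww _] := (min_repsP lam_dominant _).1 mw.
  have [mu om E] := weyl_orbit ww.
  exists [:: mu]; split=> //; first by move=> mu'; rewrite inE => /eqP ->.
  by case.
have [ww' p] := pxs 0%N isT.
have om' : orbit nus`_0 by apply/on/mem_nth; rewrite sn.
have mw' : min_reps D J w' by apply: mxs; rewrite !inE eqxx orbT.
have [mu [cmu om _ Emu lmu]] := path_b_chain p mw' om' (En 0%N isT).
exists (mu :: nus); split.
- by rewrite /= sn.
- by move=> mu'; rewrite inE => /orP[/eqP ->//|/on].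
- by case.
- case=> [_|k kx]; last by have := cn k kx; rewrite nth_behead.
  (* Equality of the two lifts would make the neighbouring representatives equal. *)
  split=> //; case: lmu => // E; case: ww'.
  apply: (min_reps_inj lam_dominant) => //.
  by rewrite -Emu -E (En 0%N isT).
Qed.

End Lifts.

(** * Piecewise-linear maps in closed form *)

Section PiecewiseLinear.
Context {R : realType}.
Implicit Types (b : seq rat).

Local Notation brk b := (fun i : nat => ratr b`_i : R).

Lemma breakpoints_homo s b : breakpoints s b -> forall i j, (i <= j <= s)%N ->
  brk b i <= brk b j.
Proof.
move=> [_ _ _ H] i j; elim: j => [|j IH]; first by rewrite leqn0 => /andP[/eqP ->].
rewrite leq_eqVlt ltnS => /andP[/orP[/eqP -> //|ij] js].
apply: le_trans (IH _) _; first by rewrite ij ltnW.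
by rewrite ler_rat ltW // H.
Qed.

Lemma breakpoints_gt0 s b : breakpoints s b -> (0 < s)%N.
Proof. by case: s => // -[_ -> /eqP]; rewrite eq_sym oner_eq0. Qed.

(** With [m i] the minimum of t and the breakpoint b_i, increments beyond t vanish, so one sum over
    all pieces gives the value at t without locating t. *)
Definition pl_sum (V : lmodType R) s (nu : nat -> V) (m : nat -> R) : V :=
  \sum_(0 <= i < s) (m i.+1 - m i) *: nu i.

Lemma pl_sum_piece (V : lmodType R) (nu : seq V) s b (t : R) l :
  breakpoints s b -> (1 <= l <= s)%N -> ratr b`_l.-1 <= t <= ratr b`_l ->
  pl_sum s (nth 0 nu) (fun i => Num.min t (brk b i)) =
  \sum_(1 <= k < l) ratr (b`_k - b`_k.-1) *: nu`_k.-1 + (t - ratr b`_l.-1) *: nu`_l.-1.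
Proof.
move=> bb; case: l => // l /= ls /andP[t1 t2].
have H := breakpoints_homo bb.
have tail : \sum_(l.+1 <= i < s)
    (Num.min t (brk b i.+1) - Num.min t (brk b i)) *: nth 0 nu i = 0.
  rewrite big_nat_cond big1 // => i /andP[/andP[li is_] _].
  rewrite !min_l ?subrr ?scale0r //; apply: le_trans t2 _; apply: H.
    by rewrite li ltnW.
  by rewrite is_ leqW.
rewrite /pl_sum (big_cat_nat (n := l)) //=; last exact: ltnW.
rewrite [X in _ + X]big_ltn // tail addr0.
congr (_ + _); last by rewrite min_l // min_r.
rewrite big_add1 /=; apply: eq_big_nat => i /andP[_ il].
by rewrite rmorphB /= !min_r //; apply: le_trans t1; apply: H; lia.
Qed.

Lemma pl_mapE (V : lmodType R) (nu : seq V) b (p : unit_interval -> V) :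
  breakpoints (size nu) b ->
  pl_map nu b p <-> forall t : unit_interval,
    p t = pl_sum (size nu) (nth 0 nu) (fun i => Num.min (val t) (brk b i)).
Proof.
move=> bb; split=> H; last first.
  by move=> l t ls tl; rewrite H (pl_sum_piece _ bb ls tl).
move=> t; have s0 := breakpoints_gt0 bb; have [_ b0 b1 _] := bb.
have /andP[t0 t1] := valP t.
suff [l ls tl] : exists2 l, (1 <= l <= size nu)%N & ratr b`_l.-1 <= val t <= ratr b`_l.
  by rewrite (H l) // (pl_sum_piece _ bb ls tl).
have ex : exists l, val t <= ratr b`_l by exists (size nu); rewrite b1 rmorph1.
have [l lt lmin] := ex_minnP ex.
(* The least index is 0 only for t = 0, which belongs to the first piece. *)
case: l lt lmin => [|l] lt lmin.
  exists 1%N => //=; rewrite b0 rmorph0 t0 /=; apply: le_trans lt _.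
  by apply: (breakpoints_homo bb).
exists l.+1; first by rewrite /= lmin // b1 rmorph1.
rewrite lt andbT /= leNgt; apply/negP => h.
by have := lmin l (ltW h); rewrite ltnn.
Qed.

(** [bump k] skips the direction [k] together with the breakpoint separating it from the equal
    direction before it; the two increments add up. *)
Lemma pl_sum_merge (V : lmodType R) s (nu : nat -> V) (m : nat -> R) k :
  (0 < k < s)%N -> nu k = nu k.-1 ->
  pl_sum s.-1 (nu \o bump k) (m \o bump k) = pl_sum s nu m.
Proof.
case: k => // k; case: s => // s /= /[!ltnS] ks E.
have ks' : (k <= s)%N by apply: ltnW.
rewrite /pl_sum [LHS](big_cat_nat (n := k)) // [RHS](big_cat_nat (n := k)) ?leqW //=.
congr (_ + _).
  have bumpE i : (i <= k)%N -> bump k.+1 i = i by rewrite /bump ltnNge => ->.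
  by apply: eq_big_nat => i /andP[_ ik]; rewrite /= !bumpE // ltnW.
rewrite [LHS]big_ltn // [RHS]big_ltn ?ltnS //.
rewrite [X in _ = _ + X]big_ltn ?ltnS // E addrA -scalerDl.
rewrite /bump leqnn ltnn /= add1n add0n.
congr (_ *: _ + _); first by ring.
rewrite [RHS]big_add1 /=; apply: eq_big_nat => i /andP[ki _].
by rewrite ki (leqW ki) !add1n.
Qed.

End PiecewiseLinear.

(** * Merging equal directions, and the comparison of paths *)

Definition delete (T : Type) k (s : seq T) : seq T := take k s ++ drop k.+1 s.

Lemma size_delete (T : Type) k (s : seq T) : (k < size s)%N ->
  size (delete k s) = (size s).-1.
Proof. by move=> ks; rewrite size_cat size_take size_drop ks; lia. Qed.

Lemma nth_delete (T : Type) (x0 : T) k (s : seq T) i : (k < size s)%N ->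
  nth x0 (delete k s) i = nth x0 s (bump k i).
Proof.
move=> ks; rewrite nth_cat size_take ks /bump; case: ltnP => ik.
  by rewrite nth_take // add0n.
by rewrite nth_drop; congr nth; lia.
Qed.

Section Main.
Context {R : realType} {n : nat} (D : root_datum R n) (lam : 'cV[R]_n).
Hypothesis lam_dominant : dominant D lam.
Local Notation J := (stab_index D lam).
Local Notation qb_path b := (Relation_Operators.clos_refl_trans _ (qb_edge D lam b)).

(** Distinct directions of an LS path may differ by a multiple of delta and so project to equal
    ones, which a QLS path forbids between neighbours. Such repetitions are deleted one at a
    time. *)
Lemma merge_QLS (x : seq 'M[R]_n) (b : seq rat) (p : unit_interval -> 'cV[R]_n) :
  breakpoints (size x) b -> (forall w, w \in x -> min_reps D J w) ->
  (forall k, (1 <= k < size x)%N -> qb_path b`_k x`_k x`_k.-1) ->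
  pl_map [seq w *m lam | w <- x] b p -> QLS D lam p.
Proof.
have [N] := ubnP (size x); elim: N x b => // N IH x b /[!ltnS] xN bb mx px plp.
have [[k [kx Ek]]|H] :=
  pselect (exists k, (1 <= k < size x)%N /\ x`_k.-1 = x`_k); last first.
  exists x, b; split=> //; split=> // k kx; split; last exact: px.
  by move=> E; apply: H; exists k.
have [k0 ks] := andP kx; have [sb b0 b1 bm] := bb.
have sd : size (delete k x) = (size x).-1 by rewrite size_delete.
have kb : (k < size b)%N by rewrite sb ltnW.
have bb' : breakpoints (size (delete k x)) (delete k b).
  rewrite sd; split.
  - by rewrite size_delete // sb; lia.
  - by rewrite nth_delete // /bump leqNgt k0.
  - by rewrite nth_delete // /bump -b1; congr nth; lia.
  - move=> i ix; rewrite !nth_delete // /bump; case: (leqP k i) => ki.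
      by rewrite (leqW ki) !add1n bm //; lia.
    case: (leqP k i.+1) => ki'; last by rewrite !add0n bm //; lia.
    by rewrite add1n add0n (lt_trans (bm i _) (bm i.+1 _)) //; lia.
apply: (IH (delete k x) (delete k b)) => //.
- by rewrite sd; lia.
- by move=> w; rewrite mem_cat => /orP[/mem_take|/mem_drop]; apply: mx.
- move=> i /andP[i0 ix]; rewrite sd in ix; rewrite !nth_delete // /bump.
  have [ki|ik] := leqP k i; last first.
    have -> : (k <= i.-1)%N = false by lia.
    by rewrite !add0n; apply: px; lia.
  have [ki'|ik'] := leqP k i.-1.
    by rewrite !add1n prednK //; apply: (px i.+1); lia.
  (* At the merged place the path that ended at entry [k] ends at entry [k.-1], as these are
     equal. *)
  have -> : i.-1 = k.-1 by lia.
  have -> : i = k by lia.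
  by rewrite add0n add1n Ek; apply: (px k.+1); lia.
have bbm : breakpoints (size [seq w *m lam | w <- x]) b by rewrite size_map.
apply/pl_mapE; first by rewrite size_map.
move=> t; rewrite ((pl_mapE _ bbm).1 plp) !size_map sd.
rewrite -(@pl_sum_merge _ _ _ _ _ k) //; last first.
  rewrite (nth_map 0) // (nth_map 0) ?Ek //.
  exact: leq_ltn_trans (leq_pred k) ks.
apply: eq_big_nat => i /andP[_ ix].
rewrite /= !nth_delete //; congr (_ *: _).
have ix1 : (i.+1 < size x)%N by rewrite -ltn_predRL.
have ib : (bump k i < size x)%N by rewrite /bump; case: (k <= i)%N; [|apply: ltnW].
by rewrite [RHS](nth_map 0) ?sd // nth_delete // (nth_map 0).
Qed.

End Main.

Theorem theorem3p3 (R : realType) (n : nat) (D : root_datum R n)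
  (lam : 'cV[R]_n) (lam_weight : weight D lam) (lam_dominant : dominant D lam) :
  LS_cl D lam = QLS D lam.
Proof.
apply/seteqP; split=> [_ [q [nu [b [[bb on cn] plq]]] <-]|p [x [b [[bb mx px] plp]]]].
  apply: (@merge_QLS _ _ D lam [seq rep D lam mu | mu <- nu] b).
  - by rewrite size_map.
  - by move=> w /mapP[mu /on/repP[m _] ->].
  - move=> k; rewrite size_map => kx; have [k0 ks] := andP kx.
    rewrite !(nth_map 0) //; last exact: leq_ltn_trans (leq_pred k) ks.
    by apply: (b_chain_path lam_dominant); apply: (cn k kx).2.
  - apply/pl_mapE; first by rewrite !size_map.
    move=> t; rewrite ((pl_mapE _ bb).1 plq) !size_map /pl_sum /cl.
    rewrite (raddf_sum (@fst 'cV[R]_n R^o)); apply: eq_big_nat => i /andP[_ ix].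
    rewrite (nth_map 0) ?size_map // (nth_map 0) //=; congr (_ *: _).
    by have [_] := repP (on _ (mem_nth 0 ix)).
(* Dropping b_0 aligns each breakpoint with the junction of the entries before and after it, counted
   from 0. *)
have [|nu [sn on En cn]] := @lift_path_seq _ _ D lam lam_dominant x (behead b) mx.
  by move=> k kx; rewrite nth_behead; apply: (px k.+1).
have bbn : breakpoints (size nu) b by rewrite sn.
pose q (t : unit_interval) :=
  pl_sum (size nu) (nth 0 nu) (fun i => Num.min (val t) (ratr b`_i : R)).
exists q.
  exists nu, b; split; last exact/pl_mapE.
  split=> // k; rewrite sn; case: k => // k kx; have := cn k kx.
  by rewrite nth_behead.
have bbm : breakpoints (size [seq w *m lam | w <- x]) b by rewrite size_map.
apply/funext => t; rewrite ((pl_mapE _ bbm).1 plp) /q /pl_sum /cl size_map sn.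
rewrite (raddf_sum (@fst 'cV[R]_n R^o)); apply: eq_big_nat => i /andP[_ ix].
by rewrite /= (nth_map 0) // -En.
Qed.
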